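(* Let $\mathcal{G}\subseteq\mathcal{H}$ be a subgroup (with respect to $\star$) for which the quotient space $\mathcal{H}/\mathcal{G}$ is Hausdorff, and let $\mathcal{K}\subseteq\mathcal{H}$ be the normal subgroup $$\mathcal{K}=\{\phi\in\mathcal{H}:\ \phi\star\psi\star\mathcal{G}=\psi\star\mathcal{G}\text{ for all }\psi\in\mathcal{H}\}.$$ (i) If there exists a smallest number $m\in\mathbb{N}$ for which $\rho_m^{-1}(\rho_m(\mathcal{G}))=\mathcal{G}$, then $\mathcal{K}=\{\phi\in\mathcal{G}:\ \phi_k=\widetilde{0}_k\text{ for all }0\le k\le m-1\}$. (ii) If $\mathcal{G}$ is a proper subset of $\rho_m^{-1}(\rho_m(\mathcal{G}))$ for every $m\in\mathbb{N}$, then $\mathcal{K}=\{\widetilde{0}\}$.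
   Context: $\mathbb{N}=\{1,2,\ldots\}$, $\mathbb{Z}_+=\{0,1,2,\ldots\}$; $\mathbb{T}$ is the unit circle in $\mathbb{C}$, a group under multiplication; $\mathbb{T}_Q=\{e^{i2\pi q}:q\in\mathbb{Q}\}$. $H(\mathbb{T})$ is the set of all (not necessarily continuous) group homomorphisms $\mathbb{T}\to\mathbb{T}$, with the topology of pointwise convergence. For $n\in\mathbb{Z}$, $n^\times\in H(\mathbb{T})$ is $x\mapsto x^n$. $\phi^{(j)}$ denotes the $j$-fold composition of $\phi$ with itself. The integers $s(k,j)$ are the (signed) Stirling numbers of the first kind: $n(n-1)\cdots(n-k+1)=\sum_{j=0}^k s(k,j)n^j$. $\mathcal{H}$ is the set of all $(\phi_k)_{k=0}^\infty\in H(\mathbb{T})^{\mathbb{Z}_+}$ with $\phi_0=1^\times=\mathrm{id}_{\mathbb{T}}$ and $\phi_k(x^{k!})=\prod_{j=1}^k\phi_1^{(j)}(x^{s(k,j)})$ for all $x\in\mathbb{T}_Q$, $k\in\mathbb{N}$, a compact space in the subspace topology of the product. It is a group (a compact right topological group) under $(\phi\star\psi)_k=\prod_{j=0}^k\phi_{k-j}\circ\psi_j$ (pointwise product), with identity $\widetilde{0}=(1^\times,0^\times,0^\times,\ldots)$. For $m\in\mathbb{N}$, $\mathcal{H}_m$ is the set of all $(\phi_k)_{k=0}^m\in H(\mathbb{T})^{\{0,\ldots,m\}}$ satisfying $\phi_0=1^\times$ and $\phi_k(x^{k!})=\prod_{j=1}^k\phi_1^{(j)}(x^{s(k,j)})$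 for all $x\in\mathbb{T}_Q$ and $1\le k\le m$, and $\rho_m:\mathcal{H}\to\mathcal{H}_m$ is the map $(\phi_k)_{k=0}^\infty\mapsto(\phi_k)_{k=0}^m$. $\mathcal{H}/\mathcal{G}$ denotes the space of left cosets $\phi\star\mathcal{G}$ with the quotient topology. *)

(* Defs.v *)
From HB Require Import structures.
From mathcomp Require Import all_boot all_order all_algebra.
From mathcomp Require Import all_classical all_reals all_analysis.
From mathcomp Require Import complex.
Set Implicit Arguments.
Unset Strict Implicit.
Unset Printing Implicit Defensive.
Import Order.TTheory GRing.Theory Num.Theory.
Import numFieldNormedType.Exports.
Local Open Scope classical_set_scope.
Local Open Scope quotient_scope.
Local Open Scope ring_scope.
Local Open Scope complex_scope.

(* [R[i]^o] is [R[i]] with the topology of its norm; a set coerced to a type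
   carries the subspace topology. *)
Definition circle (R : realType) : Type :=
  set_type [set z : R[i]^o | `|z| = 1].

Section CircleGroup.
Variable R : realType.
Implicit Types x y z : circle R.

HB.instance Definition _ := Topological.on (circle R).

Lemma norm_circle x : `|val x| = 1.
Proof. by have /set_mem := valP x. Qed.

Definition Circle (z : R[i]) (hz : `|z| = 1) : circle R :=
  exist (fun u : R[i]^o => u \in [set v : R[i]^o | `|v| = 1]) z (mem_set hz).

Lemma norm_circle1 : `|1 : R[i]| = 1. Proof. exact: normr1. Qed.

Lemma norm_circleM x y : `|(val x : R[i]) * val y| = 1.
Proof. by rewrite normrM !norm_circle mulr1. Qed.

Lemma norm_circleV x : `|(val x : R[i])^-1| = 1.
Proof. by rewrite normfV norm_circle invr1. Qed.

Definition circle_one : circle R := Circle norm_circle1.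
Definition circle_mul x y : circle R := Circle (norm_circleM x y).
Definition circle_inv x : circle R := Circle (norm_circleV x).

Lemma circle_mulA : associative circle_mul.
Proof. by move=> x y z; apply: val_inj; rewrite /= mulrA. Qed.

Lemma circle_mulC : commutative circle_mul.
Proof. by move=> x y; apply: val_inj; rewrite /= mulrC. Qed.

Lemma circle_mul1 : left_id circle_one circle_mul.
Proof. by move=> x; apply: val_inj; rewrite /= mul1r. Qed.

Lemma circle_mulr1 : right_id circle_one circle_mul.
Proof. by move=> x; rewrite circle_mulC circle_mul1. Qed.

Lemma circle_mulV : left_inverse circle_one circle_inv circle_mul.
Proof.
move=> x; apply: val_inj; rewrite /= mulVf//.
by rewrite -normr_eq0 norm_circle oner_eq0.
Qed.

Lemma circle_mulrV : right_inverse circle_one circle_inv circle_mul.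
Proof. by move=> x; rewrite circle_mulC circle_mulV. Qed.

HB.instance Definition _ := isGroup.Build (circle R)
  circle_mulA circle_mul1 circle_mulr1 circle_mulV circle_mulrV.

End CircleGroup.

Definition gzpow (T : groupType) (x : T) (n : int) : T :=
  match n with
  | Posz m => (x ^+ m)%g
  | Negz m => (x ^- m.+1)%g
  end.

Definition power_map (R : realType) (n : int) : circle R -> circle R :=
  fun x => gzpow x n.

Arguments power_map R n : clear implicits.

Definition rational_circle (R : realType) : set (circle R) :=
  [set x | exists q : rat,
     val x = cos (2 * pi * ratr q) +i* sin (2 * pi * ratr q)].

Definition stirling1 (k j : nat) : int :=
  (\prod_(i < k) ('X - (i%:Z)%:P))`_j.

Lemma stirling1E (k : nat) (n : int) :
  \prod_(i < k) (n - i%:Z) = \sum_(j < k.+1) stirling1 k j * n ^+ j.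
Proof.
set p := \prod_(i < k) ('X - (i%:Z)%:P).
have sp : size p = k.+1.
  by rewrite /p size_prod_XsubC /index_enum -enumT size_enum_ord.
have -> : \prod_(i < k) (n - i%:Z) = p.[n].
  by rewrite horner_prod; apply: eq_bigr => i _; rewrite hornerXsubC.
by rewrite horner_coef sp.
Qed.

Definition Hom (R : realType) : set {ptws circle R -> circle R} :=
  [set f : circle R -> circle R | {morph f : x y / (x * y)%g}].

Notation map_seq R := {ptws nat -> {ptws circle R -> circle R}}.

(* phi_k(x^{k!}) = \prod_{j=1}^k phi_1^{(j)}(x^{s(k,j)}) on T_Q *)
Definition stirling_relation (R : realType) (k : nat)
    (phi1 phik : circle R -> circle R) : Prop :=
  forall x, rational_circle x ->
    phik (x ^+ k`!)%g =
    (\prod_(1 <= j < k.+1) iter j phi1 (gzpow x (stirling1 k j)))%g.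

Definition calH (R : realType) : set (map_seq R) :=
  [set phi | [/\ forall k, Hom (phi k),
                 phi 0%N = power_map R 1 &
                 forall k, (0 < k)%N ->
                   stirling_relation k (phi 1%N) (phi k)]].

(* Used for 0 < m only: [inord 1] is then the index 1. *)
Definition calH_trunc (R : realType) (m : nat) :
    set {ptws 'I_m.+1 -> {ptws circle R -> circle R}} :=
  [set phi | [/\ forall k, Hom (phi k),
                 phi ord0 = power_map R 1 &
                 forall k : 'I_m.+1, (0 < k)%N ->
                   stirling_relation k (phi (inord 1)) (phi k)]].

Definition rho (R : realType) (m : nat) (phi : map_seq R) :
    {ptws 'I_m.+1 -> {ptws circle R -> circle R}} :=
  fun k => phi k.

Arguments rho {R} m phi.

Lemma rho_calH (R : realType) (m : nat) (phi : map_seq R) :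
  (0 < m)%N -> calH phi -> calH_trunc (rho m phi).
Proof.
move=> m0 [hom phi0 rel]; split => [k||k k0].
- exact: hom.
- exact: phi0.
- by rewrite /rho inordK//; exact: rel.
Qed.

Definition star (R : realType) (phi psi : map_seq R) : map_seq R :=
  fun k x => (\prod_(j < k.+1) phi (k - j)%N (psi j x))%g.

Definition zero_tilde (R : realType) : map_seq R :=
  fun k => power_map R (if k == 0%N then 1 else 0).

Arguments zero_tilde R : clear implicits.

Definition is_subgroup (R : realType) (G : set (map_seq R)) : Prop :=
  [/\ G `<=` @calH R,
      G (zero_tilde R),
      forall phi psi, G phi -> G psi -> G (star phi psi) &
      forall phi, G phi -> exists2 psi, G psi &
        star phi psi = zero_tilde R /\ star psi phi = zero_tilde R].

Definition lcoset (R : realType) (G : set (map_seq R)) (phi : map_seq R) :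
    set (map_seq R) :=
  star phi @` G.

Section CosetSpace.
Variables (R : realType) (G : set (map_seq R)).

Definition same_lcoset : rel (set_type (@calH R)) :=
  fun phi psi => `[< lcoset G (val phi) = lcoset G (val psi) >].

Lemma same_lcoset_equiv : equiv_class_of same_lcoset.
Proof.
split => [phi|phi psi|psi phi chi].
- exact/asboolP.
- by apply/asboolP/asboolP => ->.
- by move=> /asboolP e1 /asboolP e2; apply/asboolP; rewrite e1.
Qed.

Canonical same_lcoset_equiv_rel := EquivRelPack same_lcoset_equiv.

Definition coset_space := quotient_topology {eq_quot same_lcoset}.

HB.instance Definition _ := Topological.on coset_space.

End CosetSpace.

(* rho_m^{-1}(rho_m(G)), for rho_m defined on [calH R] *)
Definition saturation (R : realType) (m : nat) (G : set (map_seq R)) :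
    set (map_seq R) :=
  @calH R `&` rho m @^-1` (rho m @` G).

Definition coset_kernel (R : realType) (G : set (map_seq R)) :
    set (map_seq R) :=
  [set phi | calH phi /\
     forall psi, calH psi -> lcoset G (star phi psi) = lcoset G psi].

(* Main.v *)
(** Write the circle additively and let [low i] single out the sequences that
    are trivial in degrees [0 < k < i].  If [phi] has least nontrivial degree
    [i], then conjugating [phi] by a sequence concentrated in degree [j] with
    entry [f] changes [phi] first in degree [i + j], by
    [phi_i o f - f o phi_i].

    Suppose [phi] is in the kernel.  Commutators then give elements of [G]
    whose first nontrivial entry is [phi_i o f - f o phi_i] in degree [i + j].
    The Hausdorff hypothesis gives elements whose first entry is [f o phi_i]:
    choose [n] highly divisible and [a] with [n a = f] on a large finite set,
    [a] close to [0]; the sequence concentrated in degree [j] with entry [a]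
    tends to the identity and is congruent modulo [G] to its product with
    [phi^n], so the limits of [phi^n] and of this product both lie in [G], and
    they first differ in degree [i + j], by [f o phi_i].  Adding the two, [G]
    contains elements with first entry [phi_i o f]; since [phi_i] has dense
    image, these are dense among the homomorphisms killing torsion.  As [G] is
    closed, it contains everything trivial in degrees [1..i], that is,
    [saturation i G = G].

    In the other direction, if [saturation m G = G], an element of [G] trivial
    in degrees [0 < k < m] is central modulo degrees [> m], hence its
    conjugates stay in [G]. *)
Require Import Defs.
From HB Require Import structures.
From mathcomp Require Import all_boot all_order all_algebra.
From mathcomp Require Import all_classical all_reals all_analysis.
From mathcomp Require Import complex lra zify.
Set Implicit Arguments.
Unset Strict Implicit.
Unset Printing Implicit Defensive.
Import Order.TTheory GRing.Theory Num.Theory.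
Import numFieldNormedType.Exports.
Local Open Scope classical_set_scope.
Local Open Scope ring_scope.
Local Open Scope complex_scope.

(** * The circle *)

(** The operations are those of the multiplicative group structure, so the statements in product
    notation convert to sums and the theory of additive groups applies to them. *)
HB.instance Definition _ (R : realType) := GRing.isZmodule.Build (circle R)
  (@circle_mulA R) (@circle_mulC R) (@circle_mul1 R) (@circle_mulV R).

Section CircleMetric.
Variable R : realType.
Implicit Types (x y z : circle R) (s t e : R).

Lemma circle_val0 : val (0 : circle R) = 1. Proof. by []. Qed.

Lemma circle_valD x y : val (x + y) = val x * val y :> R[i]. Proof. by []. Qed.

Lemma circle_valN x : val (- x) = (val x)^-1 :> R[i]. Proof. by []. Qed.

Lemma circle_valMn x n : val (x *+ n) = val x ^+ n :> R[i].
Proof. by elim: n => [|n IHn]//; rewrite mulrS circle_valD IHn exprS. Qed.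

Lemma circle_gzpowE x (k : int) : gzpow x k = x *~ k.
Proof. by case: k. Qed.

Lemma norm_cis t : `|cos t +i* sin t| = 1.
Proof. by rewrite normc_def /= cos2Dsin2 sqrtr1. Qed.

Definition cis t : circle R := Circle (norm_cis t).

Lemma cisD s t : cis (s + t) = cis s + cis t.
Proof.
apply: val_inj; rewrite circle_valD /=.
by apply/eqP; rewrite eq_complex /= cosD sinD addrC [cos s * _ + _]addrC !eqxx.
Qed.

Lemma cis0 : cis 0 = 0.
Proof. by apply: val_inj; rewrite /= cos0 sin0. Qed.

Lemma cisN t : cis (- t) = - cis t.
Proof. by apply/eqP; rewrite -addr_eq0 -cisD addNr cis0. Qed.

Lemma cisMn t n : cis (t *+ n) = cis t *+ n.
Proof. by elim: n => [|n IHn]; rewrite ?cis0// !mulrS cisD IHn. Qed.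

Lemma cisMz t (k : int) : cis (t *~ k) = cis t *~ k.
Proof. by case: k => n; rewrite ?NegzE ?mulrNz ?cisN cisMn. Qed.

Lemma cis_sum (I : Type) (r : seq I) (F : I -> R) :
  cis (\sum_(i <- r) F i) = \sum_(i <- r) cis (F i).
Proof. exact: (big_morph cis cisD cis0). Qed.

Lemma cis_surj x : exists t, [/\ - pi <= t, t <= pi & cis t = x].
Proof.
have := norm_circle x; case: x => -[a b] h /=; rewrite normc_def /= => /eqP.
rewrite eq_complex /= eqxx andbT => /eqP /(congr1 (fun u => u ^+ 2)).
rewrite sqr_sqrtr ?addr_ge0 ?sqr_ge0// expr1n => ab.
have ha : -1 <= a <= 1.
  by rewrite -ler_norml -sqrtr_sqr -sqrtr1 ler_wsqrtr// -ab lerDl sqr_ge0.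
have ha' : a \in `[(-1), 1] by rewrite in_itv.
have ca : cos (acos a) = a by apply: acosK.
have sa : sin (acos a) = `|b|.
  by rewrite sin_acos// -sqrtr_sqr -ab addrAC subrr add0r.
have [a0 ap] : 0 <= acos a /\ acos a <= pi by rewrite acos_ge0// acos_lepi.
have p0 := pi_ge0 R.
have [b0|b0] := leP 0 b.
  exists (acos a); split; [lra|lra|]; apply: val_inj => /=.
  by rewrite ca sa ger0_norm.
exists (- acos a); split; [lra|lra|]; apply: val_inj => /=.
by rewrite cosN sinN ca sa ltr0_norm// opprK.
Qed.

Lemma cos_lt1 t : 0 < t < pi *+ 2 -> cos t < 1.
Proof.
move=> /andP[t0 tp]; have e : t = (t / 2) *+ 2 by rewrite mulr2n; lra.
have : 0 < sin (t / 2).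
  by apply: sin_gt0_pi; move: tp; rewrite mulr2n => tp; apply/andP; split; lra.
rewrite {2}e cos_mulr2n cos2sin2 mulr2n => s0.
have : 0 < sin (t / 2) ^+ 2 by rewrite exprn_gt0.
lra.
Qed.

Lemma cis_eq0 t : cis t = 0 -> exists k : int, t = (pi *+ 2) *~ k.
Proof.
move=> ht; set p := pi *+ 2; have p0 : 0 < p by rewrite pmulrn_lgt0// pi_gt0.
have cp : cis p = 0.
  by apply: val_inj; rewrite /= cos2pi sin2pi.
(* The floor reduces [t] to a representative [u] in [[0, 2 pi)], where the cosine equals 1 only at
   0. *)
exists (Num.floor (t / p)); set k := Num.floor _.
have /andP[k1 k2] := floor_itv (t / p); rewrite -/k in k1 k2.
set u := t - p *~ k; have hu : cis u = 0.
  by rewrite cisD cisN cisMz cp mul0rz subr0.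
apply/eqP; rewrite -subr_eq0 -/u; apply/negPn/negP => u0.
have uE : u = (t / p - k%:~R) * p.
  by rewrite mulrBl divfK ?gt_eqF// mulrzl.
have : cos u < 1.
  apply: cos_lt1; rewrite lt_neqAle eq_sym u0 /= uE -/p.
  rewrite mulr_ge0 ?subr_ge0 ?(ltW p0)//= -[X in _ < X]mul1r ltr_pM2r// ltrBlDr.
  by rewrite addrC -[1]/(1%:~R) -intrD.
have /(congr1 val) := hu; rewrite /= => -[-> _].
by rewrite ltxx.
Qed.

Lemma circle_divisible x n : (0 < n)%N -> exists y, y *+ n = x.
Proof.
move=> n0; have [t [_ _ <-]] := cis_surj x; exists (cis (t / n%:R)).
by rewrite -cisMn -[X in cis X]mulr_natr divfK// pnatr_eq0 -lt0n.
Qed.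

(** Identifies the rational circle with the torsion subgroup, the form in which it enters all later
    arguments. *)
Lemma rational_circleP x :
  rational_circle x <-> exists2 n, (0 < n)%N & x *+ n = 0.
Proof.
have cp : cis (pi *+ 2 : R) = 0 by apply: val_inj; rewrite /= cos2pi sin2pi.
split=> [[q hq]|[n n0]].
  have -> : x = cis (2 * pi * ratr q) by apply: val_inj.
  exists `|denq q|%N; first by rewrite absz_gt0 denq_neq0.
  rewrite -cisMn -[X in cis X]mulr_natr natr_absz gtr0_norm ?denq_gt0// /ratr.
  rewrite -mulrA divfK ?intr_eq0 ?denq_neq0//.
  by rewrite mulr_natl mulrzr cisMz cp mul0rz.
have [t [_ _ <-]] := cis_surj x; rewrite -cisMn => /cis_eq0[k hk].
exists (k%:~R / n%:R); rewrite fmorph_div /= ratr_int ratr_nat.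
have n0' : n%:R != 0 :> R by rewrite pnatr_eq0 -lt0n.
suff -> : 2 * pi * (k%:~R / n%:R) = t by [].
by apply: (mulIf n0'); rewrite -[LHS]mulrA divfK// [RHS]mulr_natr hk mulrzr mulr_natl.
Qed.

(** The norm of [R[i]] takes values in [R[i]]; this real-valued variant defines a
    translation-invariant distance to which real order reasoning applies. *)
Definition cnorm x : R := Normc.normc (val x - 1 : R[i]).

Lemma cnormE x : `|val x - 1 : R[i]| = (cnorm x)%:C.
Proof. by rewrite normc_def /cnorm; case: (_ - _). Qed.

Lemma cnorm_ge0 x : 0 <= cnorm x.
Proof. by rewrite -ler0c -cnormE normr_ge0. Qed.

Lemma cnorm0 : cnorm 0 = 0.
Proof. by rewrite /cnorm circle_val0 subrr Normc.normc0. Qed.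

Lemma cnorm_eq0 x : cnorm x = 0 -> x = 0.
Proof. by move=> /Normc.eq0_normc /eqP; rewrite subr_eq0 => /eqP ?; apply: val_inj. Qed.

Lemma cnorm_distE x y : `|val x - val y : R[i]| = (cnorm (x - y))%:C.
Proof.
rewrite -cnormE circle_valD circle_valN.
have y1 : (val y : R[i]) != 0 by rewrite -normr_eq0 norm_circle oner_eq0.
have -> : val x / val y - 1 = (val x - val y) / val y :> R[i].
  by rewrite mulrBl mulfV.
by rewrite normrM normfV norm_circle invr1 mulr1.
Qed.

Lemma cnormB x y z : cnorm (x - z) <= cnorm (x - y) + cnorm (y - z).
Proof. by rewrite -lecR rmorphD /= -!cnorm_distE ler_distD. Qed.

Lemma cnormN x : cnorm (- x) = cnorm x.
Proof.
apply: complexI; rewrite -sub0r -[in RHS](subr0 x) -!cnorm_distE.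
exact: distrC.
Qed.

Lemma cnormD x y : cnorm (x + y) <= cnorm x + cnorm y.
Proof. by have := cnormB x 0 (- y); rewrite opprK subr0 add0r. Qed.

Lemma cnormMz x (k : int) : cnorm (x *~ k) <= `|k|%:R * cnorm x.
Proof.
have H n : cnorm (x *+ n) <= n%:R * cnorm x.
  elim: n => [|n IHn]; first by rewrite cnorm0 mul0r.
  rewrite mulrS (le_trans (cnormD _ _))// mulrS mulrDl mul1r lerD2l//.
by case: k => n; [exact: H|rewrite NegzE mulrNz cnormN abszN; exact: H].
Qed.

Lemma cnorm_sum (I : eqType) (r : seq I) (F : I -> circle R) (C : I -> R) :
  {in r, forall i, cnorm (F i) <= C i} ->
  cnorm (\sum_(i <- r) F i) <= \sum_(i <- r) C i.
Proof.
move=> h; rewrite !big_seq; elim/big_ind2 : _ => //; first by rewrite cnorm0.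
by move=> x u y v hx hy; rewrite (le_trans (cnormD _ _))// lerD.
Qed.

Lemma cis_small e : 0 < e -> exists2 d, 0 < d & forall t, `|t| < d -> cnorm (cis t) < e.
Proof.
move=> e0.
(* The bound comes from the identity [cnorm (cis t) ^+ 2 = 2 - 2 * cos t]. *)
have e2 : 0 < e ^+ 2 / 2 by rewrite divr_gt0// exprn_gt0.
have /(@cvgrPdist_lt _ R^o) /(_ _ e2) /nbhs_ballP[d /= d0 hd] :=
  @continuous_cos R 0.
exists d => // t td; have := hd t; rewrite /ball /= sub0r normrN => /(_ td).
rewrite cos0 => /(le_lt_trans (ler_norm _)) hc.
rewrite -(@ltr_pXn2r _ 2) ?nnegrE ?cnorm_ge0 ?(ltW e0)// /cnorm /=.
rewrite sqr_sqrtr ?addr_ge0 ?sqr_ge0//.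
have := cos2Dsin2 t; rewrite oppr0 addr0; lra.
Qed.
End CircleMetric.

(** * Functionals on torsion-free quotients *)

Section AdditiveMaps.
Variables (U V : zmodType) (f : U -> V).
Hypothesis fD : {morph f : x y / x + y}.

Let f0 : f 0 = 0.
Proof. by apply: (addrI (f 0)); rewrite -fD !addr0. Qed.

Let fadd : {additive U -> V} :=
  HB.pack f (GRing.isNmodMorphism.Build U V f (conj f0 fD)).

Lemma morph0 : f 0 = 0. Proof. exact: f0. Qed.
Lemma morphN : {morph f : x / - x}. Proof. exact: (raddfN fadd). Qed.
Lemma morphB : {morph f : x y / x - y}. Proof. exact: (raddfB fadd). Qed.
Lemma morphMn n : {morph f : x / x *+ n}. Proof. exact: (raddfMn fadd). Qed.
Lemma morphMz (k : int) : {morph f : x / x *~ k}.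
Proof. by case: k => n x; rewrite ?NegzE ?mulrNz ?morphN morphMn. Qed.
Lemma morph_sum (I : Type) (r : seq I) (P : pred I) (F : I -> U) :
  f (\sum_(i <- r | P i) F i) = \sum_(i <- r | P i) f (F i).
Proof. exact: (raddf_sum fadd). Qed.
End AdditiveMaps.

(** * Pure subgroups and separating functionals *)

Section PureSubgroups.
Variables (R : realFieldType) (T : zmodType).
Implicit Types (A P M : set T) (x y z : T).

Definition torsion x := exists2 n, (0 < n)%N & x *+ n = 0.

Definition pure_subgroup A :=
  [/\ A 0, forall x y, A x -> A y -> A (x - y) &
      forall x n, (0 < n)%N -> A (x *+ n) -> A x].

(** For pure [A], this is the smallest pure subgroup containing [A] and [x]. *)
Definition pure_adjoin A x : set T :=
  [set y | exists2 n, (0 < n)%N & exists k : int, A (y *+ n - x *~ k)].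

Lemma torsionMn x n : (0 < n)%N -> torsion (x *+ n) -> torsion x.
Proof.
by move=> n0 [m m0]; rewrite -mulrnA => h; exists (n * m)%N; rewrite ?muln_gt0 ?n0.
Qed.

Lemma pure_subgroup_torsion : pure_subgroup torsion.
Proof.
split; first by exists 1%N.
- move=> x y [n n0 hx] [m m0 hy]; exists (n * m)%N; first by rewrite muln_gt0 n0.
  by rewrite mulrnBl mulrnA hx mul0rn mulnC mulrnA hy mul0rn subr0.
- by move=> x n; exact: torsionMn.
Qed.

Section Pure.
Variable A : set T.
Hypothesis pA : pure_subgroup A.

Lemma pureN x : A x -> A (- x).
Proof. by case: pA => A0 AB _ Ax; rewrite -sub0r; apply: AB. Qed.

Lemma pureD x y : A x -> A y -> A (x + y).
Proof. by case: (pA) => _ AB _ Ax Ay; rewrite -(opprK y); apply/AB/pureN. Qed.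

Lemma pureMn x n : A x -> A (x *+ n).
Proof.
move=> Ax; elim: n => [|n IHn]; first by case: pA.
by rewrite mulrS; apply: pureD.
Qed.

Lemma pureMz x (k : int) : A x -> A (x *~ k).
Proof.
by move=> Ax; case: k => n; rewrite ?NegzE ?mulrNz; [|apply: pureN]; apply: pureMn.
Qed.

Lemma pure_divz x (k : int) : k != 0 -> A (x *~ k) -> A x.
Proof.
case: pA => _ _ Ad; case: k => n; first by rewrite -lt0n => n0; exact: Ad.
by rewrite NegzE mulrNz => _ /pureN; rewrite opprK; apply: Ad.
Qed.

Lemma pure_subgroup_adjoin x : pure_subgroup (pure_adjoin A x).
Proof.
case: (pA) => A0 AB Ad; split.
- by exists 1%N => //; exists 0; rewrite mul0rn subr0.
- move=> y z [n n0 [k hy]] [m m0 [l hz]]; exists (n * m)%N.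
    by rewrite muln_gt0 n0.
  exists (k * m%:Z - l * n%:Z).
  have := AB _ _ (pureMn m hy) (pureMn n hz).
  rewrite !mulrnBl mulrzBr !mulrzA -!mulrnA [(m * n)%N]mulnC -!pmulrn.
  by rewrite !opprB addrACA [- (x *~ k *+ m) - _]addrC -addrACA.
- move=> y n n0 [m m0 [k hk]]; exists (n * m)%N; first by rewrite muln_gt0 n0.
  by exists k; rewrite mulrnA.
Qed.

Lemma pure_adjoin_sub x : A `<=` pure_adjoin A x.
Proof. by move=> y Ay; exists 1%N => //; exists 0; rewrite mulr0z subr0. Qed.

Lemma pure_adjoin_self x : pure_adjoin A x x.
Proof. by exists 1%N => //; exists 1; rewrite subrr; case: pA. Qed.
End Pure.

Lemma maximal_pure_subgroup P x : pure_subgroup P -> ~ P x ->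
  exists M, [/\ P `<=` M, pure_subgroup M, ~ M x &
    forall y, ~ M y -> pure_adjoin M y x].
Proof.
move=> pP nPx.
(* Zorn's lemma also asks for the union of the empty chain; imposing the conditions on the union
   with [P] makes the empty set admissible. *)
pose Q A := pure_subgroup (A `|` P) /\ ~ (A `|` P) x.
have [F FQ Ftot|A [[pA nAx] maxA]] := @Zorn_bigcup T Q.
  split; last first.
    case=> [[A FA Ax]|//]; have [_] := FQ _ FA; apply; by left.
  have ub y z : (\bigcup_(A in F) A `|` P) y -> (\bigcup_(A in F) A `|` P) z ->
    exists B, [/\ pure_subgroup B, B `<=` \bigcup_(A in F) A `|` P, B y & B z].
    have sub A : F A -> A `|` P `<=` \bigcup_(A in F) A `|` P.
      by move=> FA; apply: setSU; exact: bigcup_sup.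
    move=> [[A FA Ay]|Py] [[B FB Bz]|Pz].
    - have [AB|BA] := Ftot _ _ FA FB.
        exists (B `|` P); split; [exact: (FQ _ FB).1|exact: sub| |by left].
        by left; exact: AB.
      by exists (A `|` P); split; [exact: (FQ _ FA).1|exact: sub|left|left; exact: BA].
    - by exists (A `|` P); split; [exact: (FQ _ FA).1|exact: sub|left|right].
    - by exists (B `|` P); split; [exact: (FQ _ FB).1|exact: sub|right|left].
    - by exists P; split => // t; right.
  split; first by right; case: pP.
  - move=> y z hy hz; have [B [[_ BB _] sB By Bz]] := ub _ _ hy hz.
    exact/sB/BB.
  - move=> y n n0 hy; have [B [[_ _ Bd] sB By _]] := ub _ _ hy hy.
    exact/sB/(Bd _ _ n0).
exists (A `|` P); split => // y nAy; apply: contrapT => nx.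
apply: (maxA (pure_adjoin (A `|` P) y)).
  split; first by move=> t At; apply: pure_adjoin_sub; left.
  by move=> /(_ _ (pure_adjoin_self pA y)) Ay; apply: nAy; left.
have e : pure_adjoin (A `|` P) y `|` P = pure_adjoin (A `|` P) y.
  by rewrite setUidl// => t Pt; apply: pure_adjoin_sub; right.
by rewrite /Q e; split => //; exact: pure_subgroup_adjoin.
Qed.

(** Modulo a maximal pure subgroup [M] that avoids [x], every [y] is a rational multiple of [x]:
    [y *+ n] is congruent to [x *~ k] with [n > 0]. The functional sends [y] to [k / n]. *)
Lemma separating_functional P x : pure_subgroup P -> ~ P x ->
  exists l : T -> R, [/\ {morph l : y z / y + z}, forall y, P y -> l y = 0 & l x = 1].
Proof.
move=> pP nPx; have [M [sPM pM nMx Madj]] := maximal_pure_subgroup pP nPx.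
have Mx0 (k : int) : M (x *~ k) -> k = 0.
  by move=> h; apply/eqP/negPn/negP => k0; apply: nMx; apply: pure_divz h.
have coord y : exists p : nat * int, (0 < p.1)%N /\ M (y *+ p.1 - x *~ p.2).
  have [My|nMy] := pselect (M y).
    by exists (1%N, 0); split => //=; rewrite mulr0z subr0.
  have [n n0 [k hk]] := Madj _ nMy.
  have k0 : k != 0.
    apply/eqP => k0; apply: nMx; case: pM => _ _; apply; first exact: n0.
    by move: hk; rewrite k0 mulr0z subr0.
  have : M (y *~ k - x *~ n%:Z).
    by rewrite -opprB -pmulrn; apply: pureN.
  case: k k0 {hk} => m; rewrite ?NegzE => m0 h.
    by exists (m, n%:Z); rewrite lt0n.
  exists (m.+1, - n%:Z); split => //=.
  by have := pureN pM h; rewrite opprB mulrNz opprK mulrNz opprK addrC.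
have [c hc] := choice coord.
(* The fraction is well defined because only the zero multiple of [x] lies in [M]. *)
have uniq y (n m : nat) (k l : int) :
    M (y *+ n - x *~ k) -> M (y *+ m - x *~ l) -> k * m%:Z = l * n%:Z.
  move=> hk hl; apply/eqP; rewrite eq_sym -subr_eq0; apply/eqP; apply: Mx0.
  have := pureD pM (pureMn pM m hk) (pureN pM (pureMn pM n hl)).
  rewrite !mulrnBl mulrzBr !mulrzA -!mulrnA [(m * n)%N]mulnC -!pmulrn.
  by rewrite opprB addrC addrA subrK.
have uniqR y (n : nat) (k : int) : (0 < n)%N -> M (y *+ n - x *~ k) ->
    (c y).2%:~R / (c y).1%:R = k%:~R / n%:R :> R.
  move=> n0 hk; have [c0 hcy] := hc y; have := uniq _ _ _ _ _ hcy hk.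
  move=> /(congr1 (fun z : int => z%:~R : R)); rewrite !intrM -!pmulrn => e.
  by apply/eqP; rewrite eqr_div ?pnatr_eq0 -?lt0n//; apply/eqP.
exists (fun y => (c y).2%:~R / (c y).1%:R); split.
- move=> y z; have [y0 hy] := hc y; have [z0 hz] := hc z.
  rewrite (uniqR (y + z) ((c y).1 * (c z).1)%N
    ((c y).2 * (c z).1%:Z + (c z).2 * (c y).1%:Z)).
  + rewrite intrD !intrM -!pmulrn natrM addf_div ?pnatr_eq0 -?lt0n//.
  + by rewrite muln_gt0 y0.
  have := pureD pM (pureMn pM (c z).1 hy) (pureMn pM (c y).1 hz).
  rewrite !mulrnBl mulrzDr !mulrzA -!mulrnA [((c z).1 * _)%N]mulnC -!pmulrn.
  by rewrite addrACA -opprD mulrnDl.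
- move=> y Py; rewrite (uniqR y 1%N 0) ?mul0r//.
  by rewrite mulr0z subr0; exact: sPM.
- by rewrite (uniqR x 1%N 1) ?divr1// subrr; case: pM.
Qed.
End PureSubgroups.

(** * Integral coordinates on finite sets *)

Section Coordinates.
Variables (R : realFieldType) (T : zmodType).

(** Induction on [s]: an element outside the current [P] becomes a new basis vector, with a
    functional that vanishes on [P] as its coordinate. The functionals are defined on all of [T], so
    that they later yield homomorphisms of the whole circle. *)
Lemma rational_coordinates (s : seq T) :
  exists (P : set T) (r : nat) (e : nat -> T) (l : nat -> T -> R),
  [/\ pure_subgroup P, {in s, forall x, P x},
      forall i, {morph l i : x y / x + y} &
      forall x, P x -> exists (n : nat) (m : nat -> int), [/\ (0 < n)%N,
        forall i, (i < r)%N -> l i x *+ n = (m i)%:~R &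
        torsion (x *+ n - \sum_(0 <= i < r) e i *~ m i)]].
Proof.
elim: s => [|x s [P [r [e [l [pP sP lD hP]]]]]].
  exists (@torsion T), 0%N, (fun=> 0), (fun _ _ => 0).
  split => //; first exact: pure_subgroup_torsion.
    by move=> i x y; rewrite addr0.
  by move=> x tx; exists 1%N, (fun=> 0); split => //; rewrite big_geq// subr0.
have [Px|nPx] := pselect (P x).
  exists P, r, e, l; split => // y; rewrite inE => /predU1P[->//|]; exact: sP.
have [l0 [l0D l0P l0x]] := separating_functional R pP nPx.
(* Subtracting [l i x * l0 y] makes the old coordinates vanish at [x] and leaves them unchanged on
   [P]. *)
exists (pure_adjoin P x), r.+1, (fun i => if i == r then x else e i),
  (fun i y => if i == r then l0 y else l i y - l i x * l0 y); split.
- exact: pure_subgroup_adjoin.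
- move=> y; rewrite inE => /predU1P[->|/sP Py]; first exact: pure_adjoin_self.
  exact: pure_adjoin_sub.
- move=> i y z; case: eqP => _; first exact: l0D.
  by rewrite lD l0D mulrDr opprD addrACA.
move=> y [N N0 [k hy]]; have [n [m [n0 hm tm]]] := hP _ hy.
have l0y : l0 y *+ N = k%:~R.
  have := l0P _ hy; rewrite (morphB l0D) (morphMn l0D) (morphMz l0D) l0x => /eqP.
  by rewrite subr_eq0 => /eqP.
exists (N * n)%N, (fun i => if i == r then k * n%:Z else m i); split.
- by rewrite muln_gt0 N0.
- move=> i; rewrite ltnS leq_eqVlt => /predU1P[->|ir].
    by rewrite eqxx mulrnA l0y intrM -pmulrn mulr_natr.
  rewrite (ltn_eqF ir) -hm// (morphB (lD i)) (morphMn (lD i)) (morphMz (lD i)).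
  by rewrite mulrnA mulrnBl -mulrnAr l0y mulrzr.
- rewrite big_nat_recr//= eqxx (eq_big_nat _ _ (F2 := fun i => e i *~ m i)).
    move: tm; rewrite mulrnBl -mulrnA mulrzA -pmulrn opprD addrCA addrC.
    by rewrite -addrA [- _ - _]addrC addrA.
  by move=> i /andP[_ ir]; rewrite (ltn_eqF ir).
Qed.

Hypothesis divT : forall (x : T) n, (0 < n)%N -> exists y, y *+ n = x.

(** A common denominator [n] for the finite set is absorbed by multiplying the functionals by [n]
    and, by divisibility, dividing the basis vectors by [n]. *)
Lemma integral_coordinates (s : seq T) :
  exists (r : nat) (e : nat -> T) (l : nat -> T -> R),
    (forall i, {morph l i : x y / x + y}) /\
    {in s, forall x, exists m : nat -> int,
      (forall i, (i < r)%N -> l i x = (m i)%:~R) /\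
      torsion (x - \sum_(0 <= i < r) e i *~ m i)}.
Proof.
have [P [r [e [l [pP sP lD hP]]]]] := rational_coordinates s.
have [n n0 hn] : exists2 n, (0 < n)%N & {in s, forall x, exists m : nat -> int,
    (forall i, (i < r)%N -> l i x *+ n = (m i)%:~R) /\
    torsion (x *+ n - \sum_(0 <= i < r) e i *~ m i)}.
  elim: s sP => [|x s IH] sP; first by exists 1%N.
  have [|n n0 hn] := IH; first by move=> y ys; apply: sP; rewrite inE ys orbT.
  have [p [m [p0 hm tm]]] := hP _ (sP x (mem_head _ _)).
  have key y q (mu : nat -> int) t : (forall i, (i < r)%N -> l i y *+ q = (mu i)%:~R) ->
      torsion (y *+ q - \sum_(0 <= i < r) e i *~ mu i) ->
      exists m : nat -> int, (forall i, (i < r)%N -> l i y *+ (q * t) = (m i)%:~R) /\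
      torsion (y *+ (q * t) - \sum_(0 <= i < r) e i *~ m i).
    move=> h1 h2; exists (fun i => mu i * t%:Z); split.
      by move=> i ir; rewrite mulrnA h1// intrM -pmulrn mulr_natr.
    have := pureMn (pure_subgroup_torsion T) t h2.
    rewrite mulrnBl -mulrnA -sumrMnl.
    by under eq_bigr do rewrite pmulrn -mulrzA.
  exists (n * p)%N; first by rewrite muln_gt0 n0.
  move=> y; rewrite inE => /predU1P[->|ys]; first by rewrite mulnC; exact: key hm tm.
  by have [mu [h1 h2]] := hn _ ys; exact: key h1 h2.
have [e' he'] := choice (fun i => divT (e i) n0).
exists r, e', (fun i x => l i x *+ n); split.
  by move=> i x y; rewrite lD mulrnDl.
move=> x /hn[m [h1 h2]]; exists m; split => //; apply: (torsionMn n0).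
move: h2; rewrite mulrnBl -sumrMnl.
by under eq_bigr do rewrite -he' pmulrn mulrzAC -pmulrn.
Qed.
End Coordinates.

(** * Homomorphisms of the circle *)

Section CircleHoms.
Variable R : realType.
Implicit Types (x y z : circle R) (s : seq (circle R)) (e : R).

Lemma morph_torsion (U V : zmodType) (f : U -> V) :
  {morph f : u v / u + v} -> forall u, torsion u -> torsion (f u).
Proof.
by move=> fD u [n n0 hu]; exists n => //; rewrite -(morphMn fD) hu (morph0 fD).
Qed.

Lemma real_morph_torsion (l : circle R -> R) x :
  {morph l : x y / x + y} -> torsion x -> l x = 0.
Proof.
move=> lD [n n0 hx]; have := morphMn lD n x; rewrite hx (morph0 lD) => /esym/eqP.
by rewrite mulrn_eq0 eqn0Ngt n0 => /eqP.
Qed.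

(** Choose an angle [t i] for each [y i] and take the combination of the [l i] with these
    coefficients; at integral coordinates [cis] turns it into the required sum. *)
Lemma circle_hom_lift (r : nat) (y : nat -> circle R)
    (l : nat -> circle R -> R) : (forall i, {morph l i : x y / x + y}) ->
  exists L : circle R -> R, {morph L : x y / x + y} /\
    forall x (m : nat -> int), (forall i, (i < r)%N -> l i x = (m i)%:~R) ->
      cis (L x) = \sum_(0 <= i < r) y i *~ m i.
Proof.
move=> lD; have [t ht] := choice (fun i => cis_surj (y i)).
exists (fun x => \sum_(0 <= i < r) t i * l i x); split.
  by move=> u v; rewrite -big_split; apply: eq_bigr => i _; rewrite lD mulrDr.
move=> x m hm; rewrite cis_sum; apply: eq_big_nat => i /andP[_ ir].
by rewrite hm// mulrzr cisMz; have [_ _ ->] := ht i.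
Qed.

Lemma hom_coordinates (h : circle R -> circle R) r (e : nat -> circle R)
    (m : nat -> int) x :
  {morph h : x y / x + y} -> (forall x, torsion x -> h x = 0) ->
  torsion (x - \sum_(0 <= i < r) e i *~ m i) ->
  h x = \sum_(0 <= i < r) h (e i) *~ m i.
Proof.
move=> hD ht /ht; rewrite (morphB hD) (morph_sum hD) => /eqP.
rewrite subr_eq0 => /eqP ->; apply: eq_bigr => i _; exact: (morphMz hD).
Qed.

(** A lift to real values can be divided by integers while remaining additive, which is how roots of
    [h] are made. *)
Lemma lift_on_finite s (h : circle R -> circle R) :
  {morph h : x y / x + y} -> (forall x, torsion x -> h x = 0) ->
  exists L : circle R -> R, {morph L : x y / x + y} /\
    {in s, forall x, cis (L x) = h x}.
Proof.
move=> hD ht.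
have [r [e [l [lD hs]]]] := integral_coordinates R (@circle_divisible R) s.
have [L [LD hL]] := circle_hom_lift r (fun i => h (e i)) lD.
exists L; split => // x /hs[m [lm tm]].
by rewrite (hL _ _ lm) (hom_coordinates hD ht tm).
Qed.

Lemma small_root s1 s2 (h : circle R -> circle R) M e :
  {morph h : x y / x + y} -> (forall x, torsion x -> h x = 0) ->
  (0 < M)%N -> 0 < e ->
  exists (n : nat) (a : circle R -> circle R),
  [/\ (0 < n)%N, (M %| n)%N,
      {morph a : x y / x + y} /\ (forall x, torsion x -> a x = 0),
      {in s1, forall x, cnorm (a x) < e} & {in s2, forall x, a x *+ n = h x}].
Proof.
move=> hD ht M0 e0; have [L [LD hL]] := lift_on_finite (s1 ++ s2) hD ht.
have [d d0 hd] := cis_small e0.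
set B := \sum_(x <- s1) `|L x|.
have B0 : 0 <= B by apply: sumr_ge0.
(* [B] dominates [L] on [s1], so after division by a multiple of [K] the angles there are below
   [d]. *)
set K := (Num.truncn (B / d)).+1.
have K0 : 0 < K%:R :> R by rewrite ltr0n.
have n0 : (0 < M * K)%N by rewrite muln_gt0 M0.
have nR : 0 < (M * K)%:R :> R by rewrite ltr0n.
exists (M * K)%N, (fun x => cis (L x / (M * K)%:R)); split => //.
- exact: dvdn_mulr.
- split => [x y|x tx]; first by rewrite LD mulrDl cisD.
  by rewrite (real_morph_torsion LD tx) mul0r cis0.
- move=> x xs; apply: hd; rewrite normrM [`|_^-1|]gtr0_norm ?invr_gt0//.
  rewrite ltr_pdivrMr//.
  have LB : `|L x| <= B.
    by rewrite /B (big_rem x)//= lerDl sumr_ge0.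
  apply: (le_lt_trans LB); have : B / d < K%:R.
    by rewrite /K; case/andP: (truncn_itv (divr_ge0 B0 (ltW d0))).
  rewrite ltr_pdivrMr// mulrC => /lt_le_trans; apply.
  by rewrite ler_pM2l// ler_nat leq_pmull.
- move=> x xs; rewrite -cisMn -[X in cis X]mulr_natr divfK ?gt_eqF//.
  by rewrite hL// mem_cat xs orbT.
Qed.

(** Dirichlet's pigeonhole argument: two multiples of [w] fall into the same short arc, and their
    difference is a small multiple, nonzero by the assumption on [w]. *)
Lemma close_multiples e : 0 < e -> exists N, forall w : circle R,
  (forall k, (0 < k)%N -> (k <= N)%N -> w *+ k != 0) ->
  exists (k : int) t, [/\ w *~ k = cis t, 0 < t & t < e].
Proof.
move=> e0; have p0 := pi_gt0 R.
set N := (Num.truncn (pi *+ 2 / e)).+1.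
have p2 : 0 < pi *+ 2 :> R by rewrite pmulrn_lgt0.
have NR : 0 < N%:R :> R by rewrite ltr0n.
have Ne : pi *+ 2 < e * N%:R.
  rewrite mulrC -ltr_pdivrMr//.
  by case/andP: (truncn_itv (divr_ge0 (ltW p2) (ltW e0))).
(* The angle [pi] may land in an extra box, so there are [N.+1] boxes for the [N.+2] multiples with
   index from 0 to [N.+1]. *)
exists N.+1 => w hw.
have [t ht] := choice (fun k : nat => cis_surj (w *+ k)).
pose v k := (t k + pi) * N%:R / (pi *+ 2).
have v0 k : 0 <= v k.
  have [t1 _ _] := ht k; apply: divr_ge0; last exact: ltW.
  by apply: mulr_ge0; [rewrite -lerBlDr sub0r|exact: ltW].
have vN k : v k < N.+1%:R.
  have [_ t2 _] := ht k; rewrite ltr_pdivrMr// -(natr1 N) [X in _ < X]mulrDl mul1r.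
  rewrite (@le_lt_trans _ _ (N%:R * (pi *+ 2)))//; last by rewrite ltrDl.
  by rewrite mulrC ler_pM2l// mulr2n lerD2r.
have itv k : (Num.truncn (v k))%:R <= v k < (Num.truncn (v k)).+1%:R.
  exact: truncn_itv.
have bN k : (Num.truncn (v k) < N.+1)%N.
  by rewrite -(ltr_nat R); case/andP: (itv k) => /le_lt_trans h _; apply: h.
pose box (k : 'I_N.+2) : 'I_N.+1 := Ordinal (bN k).
have /injectivePn[k [l kl]] : ~~ injectiveb box.
  by apply/injectiveP => /leq_card; rewrite !card_ord ltnn.
move=> /(congr1 val) /= b.
have close i j : Num.truncn (v i) = Num.truncn (v j) -> t i - t j < e.
  move=> ij; have /andP[_ h1] := itv i; have /andP[h2 _] := itv j.
  have h : v i - v j < 1.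
    by rewrite ltrBlDr (lt_le_trans h1)// ij -natr1 addrC lerD2l.
  move: h; rewrite /v -mulrBl -mulrBl opprD addrACA subrr addr0.
  rewrite ltr_pdivrMr// mul1r => h; rewrite -(ltr_pM2r NR).
  exact: lt_trans h Ne.
have nz i j : (i < j)%N -> (j <= N.+1)%N ->
    cis (t j - t i) = w *+ (j - i) /\ t j - t i != 0.
  move=> ij jN; have [_ _ hi] := ht i; have [_ _ hj] := ht j.
  have E : cis (t j - t i) = w *+ (j - i).
    by rewrite cisD cisN hi hj (mulrnBr _ (ltnW ij)).
  split => //; apply/eqP => t0; move: E; rewrite t0 cis0 => /esym/eqP.
  apply/negP; apply: hw; first by rewrite subn_gt0.
  exact: leq_trans (leq_subr _ _) jN.
have main i j : (i < j)%N -> (j <= N.+1)%N -> Num.truncn (v i) = Num.truncn (v j) ->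
    exists (k : int) t, [/\ w *~ k = cis t, 0 < t & t < e].
  move=> ij jN bb; have [E n0] := nz _ _ ij jN.
  have [t0|t0] := ltP 0 (t j - t i).
    by exists (j - i)%N, (t j - t i); split => //; apply: close.
  exists (- (j - i)%:Z), (t i - t j); split; last exact: close.
    by rewrite mulrNz -[_ *~ _]E -cisN opprB.
  by rewrite -opprB oppr_gt0 lt_neqAle n0.
have kl' : val k != val l by [].
by case: (ltngtP k l) kl' => // h _; apply: (main _ _ h) => //; rewrite -ltnS.
Qed.

(** If [y] is a root of [y1] of order [N!], then no multiple of [f y] by a positive [k <= N]
    vanishes, since [k] divides [N!] and [f y1] is nonzero. Hence some multiple of [f y] is a short
    rotation, and its multiples come close to every point. *)
Lemma dense_image (f : circle R -> circle R) y1 z e :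
  {morph f : x y / x + y} -> f y1 != 0 -> 0 < e -> exists y, cnorm (f y - z) < e.
Proof.
move=> fD fy1 e0; have [d d0 hd] := cis_small e0.
have [N hN] := close_multiples d0.
have [y hy] := circle_divisible y1 (fact_gt0 N).
have [|k [t [kt t0 td]]] := hN (f y).
  move=> k k0 kN; apply: contraNneq fy1 => fk.
  have /dvdnP[q hq] : (k %| N`!)%N by rewrite dvdn_fact// k0.
  by rewrite -hy (morphMn fD) hq mulnC mulrnA fk mul0rn.
have [v [_ _ <-]] := cis_surj z.
exists (y *~ (k * Num.floor (v / t))); rewrite (morphMz fD) mulrzA kt -cisMz.
rewrite -cisN -cisD; apply: hd; rewrite distrC; apply: le_lt_trans td.
have /andP[h1 h2] := floor_itv (v / t).
rewrite -mulrzl ger0_norm ?subr_ge0 -?ler_pdivlMr// lerBlDr -{1}[t]mul1r.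
by rewrite -mulrDl -ler_pdivrMr// addrC -[1]/(1%:~R) -intrD ltW.
Qed.

(** Density of the image is applied at the finitely many basis vectors, and the chosen preimages are
    extended to a homomorphism through real coordinates. *)
Lemma approx_comp (f h : circle R -> circle R) y1 s e :
  {morph f : x y / x + y} -> f y1 != 0 ->
  {morph h : x y / x + y} -> (forall x, torsion x -> h x = 0) -> 0 < e ->
  exists g : circle R -> circle R,
  [/\ {morph g : x y / x + y}, forall x, torsion x -> g x = 0 &
      {in s, forall x, cnorm (f (g x) - h x) < e}].
Proof.
move=> fD fy1 hD ht e0.
have [r [b [l [lD hs]]]] := integral_coordinates R (@circle_divisible R) s.
pose B := \sum_(x <- s) \sum_(0 <= i < r) `|l i x|.
have B0 : 0 <= B by apply: sumr_ge0 => x _; apply: sumr_ge0.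
(* The error at [x] is at most this number times the sum of the absolute coordinates of [x], which
   [B] bounds. *)
have e1 : 0 < e / (B + 1) by rewrite divr_gt0// ltr_wpDl.
have [y hy] := choice (fun i => dense_image (h (b i)) fD fy1 e1).
have [L [LD hL]] := circle_hom_lift r y lD.
exists (fun x => cis (L x)); split.
- by move=> u v; rewrite LD cisD.
- by move=> x tx; rewrite (real_morph_torsion LD tx) cis0.
move=> x xs; have [m [lm tm]] := hs _ xs.
rewrite (hL _ _ lm) (hom_coordinates hD ht tm) (morph_sum fD) -sumrB.
apply: (@le_lt_trans _ _ (\sum_(0 <= i < r) `|l i x| * (e / (B + 1)))).
  apply: cnorm_sum => i; rewrite mem_index_iota => /andP[_ ir].
  rewrite (morphMz fD) -mulrzBl lm// (le_trans (cnormMz _ _))//.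
  by rewrite -intr_norm natr_absz ler_wpM2l ?ler0z// ltW.
rewrite -mulr_suml mulrA ltr_pdivrMr ?ltr_wpDl// mulrC ltr_pM2l//.
rewrite (@le_lt_trans _ _ B) ?ltrDl// /B (big_rem x)//= lerDl sumr_ge0// => u _.
exact: sumr_ge0.
Qed.

(** Compactness of the circle, obtained from that of the segment of angles. *)
Lemma circle_ultra_limit (I : Type) (F : set_system I) (u : I -> circle R) :
  UltraFilter F -> exists a, forall e, 0 < e -> F [set i | cnorm (u i - a) < e].
Proof.
move=> UF; have [t ht] := choice (fun i => cis_surj (u i)).
have tF : (t @ F) `[- pi, pi]%classic.
  by apply: nearW => i /=; have [h1 h2 _] := ht i; rewrite in_itv /= h1.
have [a [_ ca]] := segment_compact _ tF.
exists (cis a) => e e0; have [d d0 hd] := cis_small e0.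
have [ta|nta] := in_ultra_setVsetC [set i | `|a - t i| < d] UF.
  apply: filterS ta => i /= h; have [_ _ <-] := ht i.
  by rewrite -cisN -cisD; apply: hd; rewrite distrC.
by have [v [/= nv /nv]] := ca (~` ball a d) _ nta (nbhsx_ballx _ _ d0).
Qed.
End CircleHoms.

(** * The star product *)

Section StarAlgebra.
Variable R : realType.
Implicit Types (phi psi chi a b p : map_seq R) (x : circle R).
Implicit Types (f : circle R -> circle R).

Definition homs phi := forall k, {morph phi k : x y / x + y}.

Definition unital phi := forall x, phi 0%N x = x.

Lemma zero_tildeE k x : zero_tilde R k x = if k == 0%N then x else 0.
Proof. by rewrite /zero_tilde /power_map circle_gzpowE; case: eqP. Qed.

Lemma homs_zero_tilde : homs (zero_tilde R).
Proof. by move=> k x y; rewrite !zero_tildeE; case: eqP => //; rewrite addr0. Qed.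

Lemma starE phi psi k x : star phi psi k x = \sum_(j < k.+1) phi (k - j)%N (psi j x).
Proof. by []. Qed.

Lemma star0 phi psi x : star phi psi 0%N x = phi 0%N (psi 0%N x).
Proof. by rewrite starE big_ord_recl big_ord0 addr0. Qed.

Lemma star1l : left_id (zero_tilde R) (@star R).
Proof.
move=> phi; apply/funext => k; apply/funext => x.
rewrite starE big_ord_recr /= subnn zero_tildeE /= big1 ?add0r// => j _.
by rewrite zero_tildeE subn_eq0 leqNgt ltn_ord.
Qed.

Lemma star1r phi : homs phi -> star phi (zero_tilde R) = phi.
Proof.
move=> hphi; apply/funext => k; apply/funext => x.
rewrite starE big_ord_recl /= subn0 zero_tildeE /= big1 ?addr0// => j _.
by rewrite zero_tildeE /= (morph0 (hphi _)).
Qed.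

(** Both sides sum [phi (k - m) (psi (m - j) (chi j x))] over [j <= m <= k]; additivity of [phi]
    distributes it over the inner sum. *)
Lemma starA phi psi chi : homs phi ->
  star (star phi psi) chi = star phi (star psi chi).
Proof.
move=> hphi; apply/funext => k; apply/funext => x; rewrite !starE.
pose F m j := phi (k - m)%N (psi (m - j)%N (chi j x)).
transitivity (\sum_(j < k.+1) \sum_(m < k.+1 | (j <= m)%N) F m j).
  apply: eq_bigr => j _; rewrite starE.
  rewrite -(big_mkord xpredT (fun l => phi (k - j - l)%N (psi l (chi j x)))).
  rewrite -(big_mkord (fun m => j <= m)%N (F^~ j)).
  rewrite -[RHS](big_nat_widenl j 0%N k.+1 xpredT (F^~ j))//.
  rewrite -[X in _ = \big[_/_]_(X <= _ < _) _](add0n (j : nat)) big_addn.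
  rewrite subSn -1?ltnS//.
  by apply: eq_bigr => l _; rewrite /F addnK [(l + j)%N]addnC subnDA.
rewrite (exchange_big_dep xpredT)//=; apply: eq_bigr => m _.
rewrite starE (morph_sum (hphi _)) -(big_mkord (fun j => j <= m)%N (F m)).
rewrite -(big_mkord xpredT (F m)) (big_nat_widen 0 m.+1 k.+1)//.
Qed.

Lemma star_homs phi psi : homs phi -> homs psi -> homs (star phi psi).
Proof.
move=> hphi hpsi k x y; rewrite !starE -big_split; apply: eq_bigr => j _.
by rewrite hpsi hphi.
Qed.

Lemma star_unital phi psi : unital phi -> unital psi -> unital (star phi psi).
Proof. by move=> h1 h2 x; rewrite star0 h1 h2. Qed.

Lemma star_recr psi a k x : unital psi ->
  star psi a k x = \sum_(j < k) psi (k - j)%N (a j x) + a k x.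
Proof. by move=> u; rewrite starE big_ord_recr /= subnn u. Qed.

(** The system is triangular with identity diagonal. The point [x] is fixed, so that cancellation
    can be used at torsion points alone. *)
Lemma star_cancel psi a b x n : unital psi ->
  (forall k, (k < n)%N -> star psi a k x = star psi b k x) ->
  forall k, (k < n)%N -> a k x = b k x.
Proof.
move=> u h; elim/ltn_ind => k IH kn; have := h _ kn; rewrite !star_recr//.
rewrite (eq_bigr (fun j : 'I_k => psi (k - j)%N (b j x))) => [/addrI//|j _].
by rewrite IH// (ltn_trans _ kn).
Qed.

Lemma star_left_division psi chi : unital psi -> homs psi -> homs chi ->
  exists g, homs g /\ star psi g = chi.
Proof.
move=> u hpsi hchi.
(* Iterating [step] solves the triangular system: the entry of degree [k] no longer changes from
   iteration [k.+1] on. *)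
pose step (g : map_seq R) : map_seq R :=
  fun k x => chi k x - \sum_(j < k) psi (k - j)%N (g j x).
pose G n : map_seq R := iter n step chi.
have stab n k : (k < n)%N -> G n k = G k.+1 k.
  elim/ltn_ind: k n => k IH [//|n] kn; apply/funext => x.
  rewrite /G !iterS /step -/(G n) -/(G k); congr (_ - _); apply: eq_bigr => j _.
  have jk := ltn_ord j.
  by rewrite (IH j jk n (leq_trans jk _))// (IH j jk k jk).
have hG n : homs (G n).
  elim: n => [//|n IH] k x y; rewrite /G iterS -/(G n) /step hchi.
  rewrite addrACA -opprD -big_split /=; congr (_ - _); apply: eq_bigr => j _.
  by rewrite IH hpsi.
exists (fun k => G k.+1 k); split; first by move=> k; exact: hG.
apply/funext => k; apply/funext => x; rewrite star_recr// /G iterS -/(G k) /step.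
rewrite addrC -addrA [- _ + _]addrC (eq_bigr (fun j : 'I_k => psi (k - j)%N (G k j x))).
  by rewrite subrr addr0.
by move=> j _; rewrite stab.
Qed.

Lemma star_agree a b p l : (forall k, (k < l)%N -> a k = b k) ->
  forall k, (k < l)%N -> star a p k = star b p k.
Proof.
move=> ab k kl; apply/funext => x; rewrite !starE; apply: eq_bigr => j _.
by rewrite ab// (leq_ltn_trans (leq_subr _ _)).
Qed.

Lemma star_agree_diff a b p l x : unital p -> (forall k, (k < l)%N -> a k = b k) ->
  star a p l x - star b p l x = a l x - b l x.
Proof.
move=> u ab; rewrite !starE !big_ord_recl /= subn0 u.
rewrite (eq_bigr (fun j : 'I_l => b (l - bump 0 j)%N (p (bump 0 j) x))).
  by rewrite opprD addrACA subrr addr0.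
by move=> j _; rewrite ab// /bump add1n ltn_subrL (leq_trans _ (ltn_ord j)).
Qed.

Definition low m phi := forall k x, (0 < k)%N -> (k < m)%N -> phi k x = 0.

Lemma star_lowl phi psi m k x : unital phi -> unital psi -> low m phi ->
  (0 < k)%N -> (k <= m)%N -> star phi psi k x = phi k x + psi k x.
Proof.
move=> u1 u2 lphi k0 km; rewrite star_recr//.
case: k k0 km => // k _ km; rewrite big_ord_recl /= u2 big1 ?addr0// => j _.
rewrite lphi// ?subn_gt0 /bump add1n ?ltnS//.
by rewrite subSS (leq_ltn_trans (leq_subr _ _)).
Qed.

Lemma star_lowr phi psi m k x : unital phi -> unital psi -> homs psi -> low m phi ->
  (0 < k)%N -> (k <= m)%N -> star psi phi k x = psi k x + phi k x.
Proof.
move=> u1 u2 hpsi lphi k0 km; rewrite star_recr//.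
case: k k0 km => // k _ km; rewrite big_ord_recl /= u1 big1 ?addr0// => j _.
rewrite lphi ?(morph0 (hpsi _))// /bump add1n.
by rewrite (leq_ltn_trans _ km).
Qed.

Definition single j f : map_seq R :=
  fun k x => if k == 0%N then x else if k == j then f x else 0.

Lemma single_homs j f : {morph f : x y / x + y} -> homs (single j f).
Proof.
move=> fD k x y; rewrite /single; case: eqP => // _; case: eqP => // _.
by rewrite addr0.
Qed.

Lemma star_singlel j f phi k x : (0 < j)%N -> star (single j f) phi k x =
  phi k x + (if (j <= k)%N then f (phi (k - j)%N x) else 0).
Proof.
move=> j0; rewrite star_recr// addrC; congr (_ + _); case: leqP => jk.
  have kj : (k - j < k)%N by rewrite ltn_subrL j0 (leq_trans j0 jk).
  rewrite (bigD1 (Ordinal kj)) //= big1 ?addr0.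
    by rewrite /single subKn// eqxx (gtn_eqF j0).
  move=> i ij; rewrite /single subn_eq0 leqNgt ltn_ord /=; case: eqP => // e.
  by case/eqP: ij; apply: val_inj; rewrite /= -e subKn// ltnW.
apply: big1 => i _; rewrite /single subn_eq0 leqNgt ltn_ord /=; case: eqP => // e.
by have := leq_subr i k; rewrite e leqNgt jk.
Qed.

Lemma star_singler j f phi k x : homs phi -> unital phi -> (0 < j)%N ->
  star phi (single j f) k x =
  phi k x + (if (j <= k)%N then phi (k - j)%N (f x) else 0).
Proof.
move=> hphi u j0; rewrite starE big_ord_recl /= subn0; congr (_ + _).
case: leqP => jk.
  case: j j0 jk => // j _ jk.
  rewrite (bigD1 (Ordinal jk)) //= big1 ?addr0.
    by rewrite /single /bump add1n /= eqxx.
  move=> i ij; rewrite /single /bump add1n /=; case: eqP => [[e]|_].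
    by case/eqP: ij; apply: val_inj.
  exact: morph0.
apply: big1 => i _; rewrite /single /bump add1n /=; case: eqP => [e|_].
  by move: jk; rewrite -e ltnS leqNgt ltn_ord.
exact: morph0.
Qed.

End StarAlgebra.

(** * Convergence *)

Section PointwiseConvergence.
Variable R : realType.

Lemma cvg_initial_topology (S : choiceType) (T : topologicalType) (f : S -> T)
    (I : Type) (F : set_system I) (u : I -> S) (s : S) : Filter F ->
  f \o u @ F --> f s -> u @ F --> (s : initial_topology f).
Proof.
move=> FF h A; rewrite nbhsE => -[B [[C oC <-] Cs] BA].
have /h : nbhs (f s) C by apply: open_nbhs_nbhs.
by move=> FC; apply: (@filterS _ F FF _ _ _ FC) => i /= ?; apply: BA.
Qed.

(** Convergence in the product topology, stated with real tolerances at single degrees and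
    points. *)
Definition ptcvg (I : Type) (F : set_system I) (u : I -> map_seq R) (a : map_seq R) :=
  forall k x (e : R), 0 < e -> F [set i | cnorm (u i k x - a k x) < e].

Lemma ptcvg_cvg (I : Type) (F : set_system I) (u : I -> map_seq R) a :
  Filter F -> ptcvg F u a -> u @ F --> a.
Proof.
move=> FF h; apply/cvg_sup => k.
apply: (@cvg_initial_topology _ _
  (fun f : (nat -> {ptws circle R -> circle R}) => f k) _ F u a).
apply/cvg_sup => x.
apply: (@cvg_initial_topology _ _ (fun f : (circle R -> circle R) => f x)
  _ F (fun i => u i k) (a k)).
apply: (@cvg_initial_topology _ _ set_val _ F (fun i => u i k x) (a k x)).
apply/(@cvgrPdist_lt _ (R[i]^o)%type) => e e0.
(* The tolerance is an element of [R[i]]; being positive there forces it to be real. *)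
have [r e_r] : exists r : R, e = r%:C%C.
  case: e e0 => r t; rewrite ltcE /= => /andP[/eqP -> _]; by exists r.
move: e0; rewrite e_r ltcR => e0; apply: filterS (h k x r e0) => i /= hi.
by rewrite distrC cnorm_distE ltcR.
Qed.

Lemma ptcvg_ultra_limit (I : Type) (F : set_system I) (u : I -> map_seq R) :
  UltraFilter F -> exists a, ptcvg F u a.
Proof.
move=> UF.
have [a ha] := choice (fun p => circle_ultra_limit (fun i => u i p.1 p.2) UF).
by exists (fun k x => a (k, x)) => k x; exact: (ha (k, x)).
Qed.

Lemma cnorm_lt_eq0 (x : circle R) : (forall e, 0 < e -> cnorm x < e) -> x = 0.
Proof.
move=> h; apply: cnorm_eq0; apply/eqP; rewrite eq_le cnorm_ge0 andbT leNgt.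
by apply/negP => /h; rewrite ltxx.
Qed.

Lemma ptcvg_homs (I : Type) (F : set_system I) (u : I -> map_seq R) a :
  ProperFilter F -> (forall i, homs (u i)) -> ptcvg F u a -> homs a.
Proof.
move=> FF hu h k x y; apply/eqP; rewrite -subr_eq0; apply/eqP.
apply: cnorm_lt_eq0 => e e0; have e3 : 0 < e / 3 by rewrite divr_gt0.
have [i /= [[h1 h2] h3]] := filter_ex (filterI (filterI (h k x _ e3) (h k y _ e3))
  (h k (x + y) _ e3)).
have -> : a k (x + y) - (a k x + a k y) =
    - (u i k (x + y) - a k (x + y)) + ((u i k x - a k x) + (u i k y - a k y)).
  by rewrite hu opprB (addrACA (u i k x)) -opprD addrA subrK.
have := cnormD (- (u i k (x + y) - a k (x + y)))
  ((u i k x - a k x) + (u i k y - a k y)).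
have := cnormD (u i k x - a k x) (u i k y - a k y).
rewrite cnormN; lra.
Qed.

Variable G : set (map_seq R).
Hypothesis hT2 : hausdorff_space (coset_space G).

(** The two families have the same image in the coset space, where limits are unique. *)
Lemma lcoset_limit (I : Type) (F : set_system I) (u v : I -> map_seq R) a b :
  ProperFilter F -> (forall i, calH (u i)) -> (forall i, calH (v i)) ->
  calH a -> calH b -> ptcvg F u a -> ptcvg F v b ->
  (forall i, lcoset G (u i) = lcoset G (v i)) -> lcoset G a = lcoset G b.
Proof.
move=> FF hu hv ha hb cu cv uv.
pose S w (hw : calH w) : set_type (@calH R) := exist _ w (mem_set hw).
pose p : set_type (@calH R) -> coset_space G := \pi_(coset_space G)%qT.
have lim (w : I -> map_seq R) (hw : forall i, calH (w i)) c (hc : calH c) :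
    ptcvg F w c -> (fun i => p (S _ (hw i))) @ F --> p (S _ hc).
  move=> cw; apply: (@cvg_comp _ _ _ (fun i => S _ (hw i)) p _ (nbhs (S _ hc))).
    by apply: cvg_initial_topology; exact: ptcvg_cvg.
  exact: pi_continuous.
have pE x y : p x = p y <-> lcoset G (val x) = lcoset G (val y).
  have h := @eqmodP _ (same_lcoset_equiv_rel G) x y.
  split=> [xy|xy]; first by apply/asboolP; exact: (introT h xy).
  by apply: (elimT h); apply/asboolP.
have e : (fun i => p (S _ (hu i))) = (fun i => p (S _ (hv i))).
  by apply/funext => i; apply: (pE _ _).2; exact: uv.
have := lim _ hu _ ha cu; rewrite e => l1.
exact: (pE _ _).1 (cvg_unique hT2 l1 (lim _ hv _ hb cv)).
Qed.
End PointwiseConvergence.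

(** * Torsion points *)

Section CalH.
Variable R : realType.
Implicit Types (phi psi chi : map_seq R) (x y : circle R) (f g : circle R -> circle R).

Definition kills_torsion f := forall x, torsion x -> f x = 0.

Lemma stirling_relationE k f g : stirling_relation k f g <->
  forall x, torsion x ->
    g (x *+ k`!) = \sum_(1 <= j < k.+1) iter j f (x *~ stirling1 k j).
Proof.
split=> h x /rational_circleP tx; have := h x tx.
  by under eq_bigr do rewrite circle_gzpowE.
by move=> ->; under [RHS]eq_bigr do rewrite circle_gzpowE.
Qed.

Lemma calH_homs phi : calH phi -> homs phi. Proof. by case. Qed.

Lemma power_map1 x : power_map R 1 x = x.
Proof. by rewrite /power_map circle_gzpowE mulr1z. Qed.

Lemma calH_unital phi : calH phi -> unital phi.
Proof. by case=> _ h _ x; rewrite h power_map1. Qed.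

Lemma calH_relation phi k x : calH phi -> (0 < k)%N -> torsion x ->
  phi k (x *+ k`!) =
    \sum_(1 <= j < k.+1) iter j (phi 1%N) (x *~ stirling1 k j).
Proof. by case=> _ _ h k0; move/stirling_relationE : (h k k0); apply. Qed.

Lemma iter_eq_torsion f g j x : {morph f : x y / x + y} ->
  (forall y, torsion y -> f y = g y) -> torsion x ->
  iter j f x = iter j g x /\ torsion (iter j f x).
Proof.
move=> fD fg tx; elim: j => [//|j [IH t]]; rewrite !iterS -IH -fg//.
by split => //; exact: morph_torsion.
Qed.

Lemma torsionMz x (k : int) : torsion x -> torsion (x *~ k).
Proof. exact: (pureMz (pure_subgroup_torsion _)). Qed.

Lemma torsion_div x n : (0 < n)%N -> torsion x -> exists2 y, torsion y & y *+ n = x.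
Proof.
move=> n0 tx; have [y yx] := circle_divisible x n0; exists y => //.
by apply: (torsionMn n0); rewrite yx.
Qed.

(** Every torsion point is [k!] times a torsion point, so the Stirling relation expresses [phi k]
    there through [phi 1]. *)
Lemma calH_torsion_ext phi psi : calH phi -> calH psi ->
  (forall x, torsion x -> phi 1%N x = psi 1%N x) ->
  forall k x, torsion x -> phi k x = psi k x.
Proof.
move=> hphi hpsi h [|k] x tx; first by rewrite !calH_unital.
have [y ty <-] := torsion_div (fact_gt0 k.+1) tx.
rewrite !calH_relation//; apply: eq_bigr => j _.
by apply: (proj1 (iter_eq_torsion _ _ h _)); [exact: calH_homs|exact: torsionMz].
Qed.

(** The Stirling sum starts at [j = 1], so each term applies [phi 1] to a multiple of [y]. *)
Lemma calH_torsion_vanish phi k y : calH phi -> torsion y -> phi 1%N y = 0 ->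
  (0 < k)%N -> phi k (y *+ k`!) = 0.
Proof.
move=> hphi ty py k0; have h1 := calH_homs hphi 1%N.
rewrite calH_relation// big_nat_cond big1// => -[//|j] _.
rewrite iterSr (morphMz h1) py mul0rz.
by elim: j => [//|j IH]; rewrite iterS IH (morph0 h1).
Qed.

(** The Stirling relations involve torsion points only, and homomorphisms map torsion to torsion. *)
Lemma calH_transfer phi psi : calH phi -> homs psi -> unital psi ->
  (forall k x, torsion x -> psi k x = phi k x) -> calH psi.
Proof.
move=> hphi hpsi upsi h; split => //.
  by apply/funext => x; rewrite power_map1; exact: upsi.
move=> k k0; apply/stirling_relationE => x tx.
rewrite h; last exact: (pureMn (pure_subgroup_torsion _)).
rewrite calH_relation//; apply: eq_bigr => j _; symmetry.
by apply: (proj1 (iter_eq_torsion _ _ (h 1%N) _)); [exact: hpsi|exact: torsionMz].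
Qed.

(** If [x] has exact order [m], it generates the [m]-th roots of unity, so every homomorphism sends
    it to a multiple of itself, and multiplications by integers commute. *)
Lemma torsion_commute f g x : {morph f : x y / x + y} -> {morph g : x y / x + y} ->
  torsion x -> f (g x) = g (f x).
Proof.
move=> fD gD [n n0 hx].
have xn : (val x : R[i]) ^+ n = 1 by rewrite -circle_valMn hx.
have [m prim _] := prim_order_exists n0 xn.
have xm : x *+ m = 0 by apply: val_inj; rewrite circle_valMn (prim_expr_order prim).
have pow (h : circle R -> circle R) : {morph h : x y / x + y} -> exists b, h x = x *+ b.
  move=> hD; have e : (val (h x) : R[i]) ^+ m = 1.
    by rewrite -circle_valMn -(morphMn hD) xm (morph0 hD).
  have [b hb] := prim_rootP prim e; exists b; apply: val_inj.
  by rewrite circle_valMn.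
have [b hb] := pow _ fD; have [c hc] := pow _ gD.
by rewrite hb hc (morphMn fD) (morphMn gD) hb hc -!mulrnA mulnC.
Qed.

Definition trivial_on_torsion chi :=
  [/\ homs chi, unital chi & forall k, (0 < k)%N -> kills_torsion (chi k)].

Lemma zero_tilde_calH : calH (zero_tilde R).
Proof.
split; [exact: homs_zero_tilde|by []|].
move=> [//|k] _; apply/stirling_relationE => x tx.
rewrite zero_tildeE/= big_nat_cond big1// => -[//|j] _.
by rewrite iterS zero_tildeE.
Qed.

Lemma trivial_on_torsion_calH chi : trivial_on_torsion chi -> calH chi.
Proof.
move=> [h1 h2 h3]; apply: (calH_transfer zero_tilde_calH) => // -[|k] x tx.
  by rewrite h2 zero_tildeE.
by rewrite zero_tildeE h3.
Qed.

Lemma trivial_on_torsion_star chi phi : trivial_on_torsion chi -> calH phi ->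
  calH (star chi phi).
Proof.
move=> [h1 h2 h3] hphi; apply: (calH_transfer hphi).
- by apply: star_homs => //; exact: calH_homs.
- by apply: star_unital => //; exact: calH_unital.
move=> k x tx; rewrite starE big_ord_recr /= subnn h2 big1 ?add0r// => j _.
rewrite h3 ?subn_gt0//; apply: morph_torsion => //; exact: calH_homs.
Qed.

Lemma single_trivial_on_torsion j f : {morph f : x y / x + y} -> kills_torsion f ->
  trivial_on_torsion (single j f).
Proof.
move=> fD ft; split => //; first exact: single_homs.
by move=> [//|k] _ x tx; rewrite /single /=; case: eqP => // _; exact: ft.
Qed.

End CalH.

(** * The kernel of the coset action *)

Section FineFilter.
Variable T : eqType.

(** The directed set of pairs of a finite set of points and an integer. The integer serves as a
    tolerance, a divisibility level and a bound on degrees. *)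
Definition fine_filter : set_system (seq T * nat) :=
  [set A : set (seq T * nat) | exists (s0 : seq T) N,
    forall (s : seq T) n, {subset s0 <= s} -> (N <= n)%N -> A (s, n)].

Lemma fine_filter_proper : ProperFilter fine_filter.
Proof.
split; first by move=> [s [N h]]; exact: (h s N).
split.
- by exists [::], 0%N.
- move=> A B [s [N hA]] [t [M hB]]; exists (s ++ t), (maxn N M) => u n stu.
  rewrite geq_max => /andP[Nn Mn]; split.
    by apply: hA => // x xs; apply: stu; rewrite mem_cat xs.
  by apply: hB => // x xs; apply: stu; rewrite mem_cat xs orbT.
- by move=> A B AB [s [N hA]]; exists s, N => t n st Nn; apply: AB; exact: hA.
Qed.

Lemma fine_filter_in x : fine_filter [set p : seq T * nat | x \in p.1].
Proof. by exists [:: x], 0%N => s n h _; apply: h; rewrite inE. Qed.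

Lemma fine_filter_ge N : fine_filter [set p : seq T * nat | (N <= p.2)%N].
Proof. by exists [::], N. Qed.

Lemma fine_filter_inv (R : realType) (e : R) : 0 < e ->
  fine_filter [set p : seq T * nat | p.2.+1%:R^-1 < e].
Proof.
move=> e0; exists [::], (Num.truncn e^-1) => s n _ Nn /=.
rewrite invf_plt ?posrE ?ltr0n//; have ei : 0 <= e^-1 by rewrite invr_ge0 ltW.
by case/andP: (truncn_itv ei) => _ /lt_le_trans; apply; rewrite ler_nat.
Qed.
End FineFilter.
#[global] Existing Instance fine_filter_proper.

Section Limits.
Variable R : realType.
Variables (I : Type) (F : set_system I).
Hypothesis FF : ProperFilter F.
Implicit Types (u v : I -> map_seq R) (a b : map_seq R).

Lemma ptcvg_const a : ptcvg F (fun=> a) a.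
Proof.
move=> k x e e0; apply: (@filterS _ F _ _ _ _ filterT) => i _ /=.
by rewrite subrr cnorm0.
Qed.

Lemma ptcvg_diff u v a b k x c : ptcvg F u a -> ptcvg F v b ->
  (forall e : R, 0 < e -> F [set i | cnorm (u i k x - v i k x - c) < e]) ->
  a k x - b k x = c.
Proof.
move=> cu cv h; apply/eqP; rewrite -subr_eq0; apply/eqP.
apply: cnorm_lt_eq0 => e e0; have e3 : 0 < e / 3 by rewrite divr_gt0.
have [i /= [[h1 h2] h3]] := filter_ex (filterI (filterI (cu k x _ e3) (cv k x _ e3))
  (h _ e3)).
have -> : a k x - b k x - c = - (u i k x - a k x) + (v i k x - b k x)
    + (u i k x - v i k x - c).
  rewrite opprB [RHS]addrA; congr (_ - c).
  rewrite [v i k x - _]addrC [X in _ = X + _]addrACA [- u i k x + _]addrC.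
  by rewrite -[v i k x - _]opprB subrK.
have := cnormD (- (u i k x - a k x) + (v i k x - b k x)) (u i k x - v i k x - c).
have := cnormD (- (u i k x - a k x)) (v i k x - b k x).
rewrite cnormN; lra.
Qed.

Lemma ptcvg_eq u a k x c : ptcvg F u a -> F [set i | u i k x = c] -> a k x = c.
Proof.
move=> cu h; rewrite -[LHS]subr0.
apply: (ptcvg_diff (b := fun _ _ => 0) cu (@ptcvg_const _)).
by move=> e e0; apply: filterS h => i /= ->; rewrite subr0 subrr cnorm0.
Qed.
End Limits.

(** * Limits and leading entries of elements of the subgroup *)

Section Subgroup.
Variables (R : realType) (G : set (map_seq R)).
Hypotheses (hG : is_subgroup G) (hT2 : hausdorff_space (coset_space G)).
Implicit Types (phi psi chi g : map_seq R).

Let GH : G `<=` @calH R. Proof. by case: hG. Qed.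
Let G1 : G (zero_tilde R). Proof. by case: hG. Qed.
Let GM phi psi : G phi -> G psi -> G (star phi psi).
Proof. by case: hG => _ _ h _; exact: h. Qed.
Let GV phi : G phi -> exists2 psi, G psi &
  star phi psi = zero_tilde R /\ star psi phi = zero_tilde R.
Proof. by case: hG => _ _ _ h; exact: h. Qed.

Lemma lcoset_starr phi g : homs phi -> G g -> lcoset G (star phi g) = lcoset G phi.
Proof.
move=> hphi Gg; apply/seteqP; split => [_ [h Gh <-]|_ [h Gh <-]].
  by exists (star g h); [exact: GM|rewrite starA].
have [g' Gg' [gg' _]] := GV Gg; exists (star g' h); first exact: GM.
rewrite starA// -(starA _ h); last exact/calH_homs/GH.
by rewrite gg' star1l.
Qed.

Lemma lcoset_zero_tilde : lcoset G (zero_tilde R) = G.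
Proof.
apply/seteqP; split => [_ [h Gh <-]|h Gh]; first by rewrite star1l.
by exists h; rewrite ?star1l.
Qed.

Lemma lcoset_self phi : homs phi -> lcoset G phi phi.
Proof. by move=> hphi; exists (zero_tilde R); rewrite ?star1r. Qed.

Lemma coset_kernel_sub : coset_kernel G `<=` G.
Proof.
move=> phi [hphi /(_ _ (zero_tilde_calH R))].
rewrite star1r ?lcoset_zero_tilde; last exact: calH_homs.
by move=> <-; exact/lcoset_self/calH_homs.
Qed.

(** The cosets of [u i] and of [star (u i) (v i)] coincide, hence so do those of their limits, the
    identity and [b]. *)
Lemma limit_mod_subgroup (I : Type) (F : set_system I) (u v : I -> map_seq R) b :
  ProperFilter F -> (forall i, trivial_on_torsion (u i)) -> (forall i, G (v i)) ->
  ptcvg F u (zero_tilde R) -> calH b -> ptcvg F (fun i => star (u i) (v i)) b -> G b.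
Proof.
move=> FF hu Gv cu hb cuv; rewrite -lcoset_zero_tilde.
rewrite (@lcoset_limit _ _ hT2 _ _ _ _ _ b FF _ _ (zero_tilde_calH R) hb cu cuv).
- exact/lcoset_self/calH_homs.
- by move=> i; exact: trivial_on_torsion_calH.
- by move=> i; apply: trivial_on_torsion_star => //; exact: GH.
by move=> i; rewrite lcoset_starr//; case: (hu i).
Qed.

Lemma limit_in_subgroup (I : Type) (F : set_system I) (v : I -> map_seq R) b :
  ProperFilter F -> (forall i, G (v i)) -> calH b -> ptcvg F v b -> G b.
Proof.
move=> FF Gv hb cv; apply: (limit_mod_subgroup FF (u := fun=> zero_tilde R) _ Gv) => //.
- move=> _; split; [exact: homs_zero_tilde|by []|].
  by move=> [//|k] _ x _; rewrite zero_tildeE.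
- exact: ptcvg_const.
- by move: cv; congr (ptcvg F _ b); apply/funext => i; rewrite star1l.
Qed.

(** The degree [l] piece of the graded group attached to the filtration of [G] by the subsets
    [low l]. *)
Definition leading l (f : circle R -> circle R) :=
  exists c, [/\ G c, low l c & forall x, c l x = f x].

(** The element is [a] times the inverse of [b]: right multiplication leaves the first discrepancy
    unchanged. *)
Lemma leading_diff a b l : (0 < l)%N -> G a -> G b ->
  (forall k x, (k < l)%N -> a k x = b k x) -> leading l (fun x => a l x - b l x).
Proof.
move=> l0 Ga Gb h; have ab k : (k < l)%N -> a k = b k.
  by move=> kl; apply/funext => x; exact: h.
have [b' Gb' [bb' _]] := GV Gb; have ub' := calH_unital (GH Gb').
exists (star a b'); split; first exact: GM.
  move=> k x k0 kl; rewrite (star_agree _ ab)// bb' zero_tildeE.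
  by rewrite eqn0Ngt k0.
move=> x; rewrite -(star_agree_diff x ub' ab) bb' zero_tildeE.
by rewrite eqn0Ngt l0 subr0.
Qed.

Lemma leadingD l f1 f2 : (0 < l)%N -> leading l f1 -> leading l f2 ->
  leading l (fun x => f1 x + f2 x).
Proof.
move=> l0 [c [Gc lc cf]] [d [Gd ld dg]].
have uc := calH_unital (GH Gc); have ud := calH_unital (GH Gd).
exists (star c d); split; first exact: GM.
  by move=> k x k0 kl; rewrite (star_lowl _ uc ud lc k0 (ltnW kl)) lc// ld// addr0.
by move=> x; rewrite (star_lowl _ uc ud lc)// cf dg.
Qed.

Lemma leading_commutator phi i j (f : circle R -> circle R) :
  coset_kernel G phi -> (0 < i)%N -> (0 < j)%N -> low i phi ->
  {morph f : x y / x + y} -> kills_torsion f ->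
  leading (i + j) (fun x => phi i (f x) - f (phi i x)).
Proof.
move=> Kphi i0 j0 lphi fD ft; have Gphi := coset_kernel_sub Kphi.
have hphi := GH Gphi; have [hh uu] := (calH_homs hphi, calH_unital hphi).
set S := single j f; have tS : trivial_on_torsion S by exact: single_trivial_on_torsion.
have [hS uS _] := tS.
have [_ /(_ _ (trivial_on_torsion_calH tS)) e] := Kphi.
have : lcoset G S (star phi S) by rewrite -e; exact/lcoset_self/star_homs.
move=> [g Gg Sg].
(* This compares [star S g] with [star phi S] in degree [k]; thus [g] is the conjugate of [phi] by
   [S]. *)
have E k x : g k x + (if (j <= k)%N then f (g (k - j)%N x) else 0) =
    phi k x + (if (j <= k)%N then phi (k - j)%N (f x) else 0).
  by rewrite -(star_singlel f g k x j0) -(star_singler f k x hh uu j0) Sg.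
have gphi k x : (k < i + j)%N -> g k x = phi k x.
  move: k; apply: (star_cancel uS) => k kij.
  rewrite !star_singlel// E; congr (_ + _); case: leqP => // jk.
  have [->|kj] := posnP (k - j)%N; first by rewrite !uu.
  have kji : (k - j < i)%N by rewrite ltn_subLR// addnC.
  by rewrite !lphi// (morph0 fD).
have ij0 : (0 < i + j)%N by rewrite addn_gt0 i0.
have [c [Gc lc cE]] := leading_diff ij0 Gg Gphi gphi.
exists c; split => // x; rewrite cE; have := E (i + j)%N x.
have ij : (i < i + j)%N by lia.
rewrite leq_addl addnK (gphi i)//.
by move=> /eqP; rewrite -subr_eq0 opprD addrACA addr_eq0 opprB => /eqP.
Qed.

Fixpoint gpow phi n : map_seq R :=
  if n is n'.+1 then star phi (gpow phi n') else zero_tilde R.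

Lemma gpow_in phi n : G phi -> G (gpow phi n).
Proof. by move=> Gphi; elim: n => [//|n IH]; exact: GM. Qed.

Lemma gpow_low phi n i k x : G phi -> low i phi -> (0 < k)%N -> (k <= i)%N ->
  gpow phi n k x = phi k x *+ n.
Proof.
move=> Gphi lphi k0 ki; elim: n => [|n IH] /=.
  by rewrite zero_tildeE eqn0Ngt k0.
rewrite (star_lowl _ _ _ lphi)// ?IH ?mulrS//; apply: calH_unital; apply: GH => //.
exact: gpow_in.
Qed.

Lemma leading_comp phi i j (f : circle R -> circle R) :
  G phi -> (0 < i)%N -> (0 < j)%N -> low i phi ->
  {morph f : x y / x + y} -> kills_torsion f ->
  leading (i + j) (fun x => f (phi i x)).
Proof.
move=> Gphi i0 j0 lphi fD ft.
have hphi := GH Gphi; have [hh uu] := (calH_homs hphi, calH_unital hphi).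
(* The root property is required on the image of the finite set under [phi i], smallness on the set
   itself. *)
have root (p : seq (circle R) * nat) : exists na : nat * (circle R -> circle R),
    [/\ (p.2`! %| na.1)%N, {morph na.2 : x y / x + y}, kills_torsion na.2,
      {in p.1, forall x, cnorm (na.2 x) < p.2.+1%:R^-1} &
      {in p.1, forall x, na.2 (phi i x) *+ na.1 = f (phi i x)}].
  have e0 : 0 < p.2.+1%:R^-1 :> R by rewrite invr_gt0 ltr0n.
  have [n [a [_ h1 [h2 h3] h4 h5]]] :=
    small_root p.1 (map (phi i) p.1) fD ft (fact_gt0 p.2) e0.
  exists (n, a); split => // x xp; apply: h5; exact: map_f.
have [na hna] := choice root.
(* Along an ultrafilter finer than the fine filter both families converge. *)
have [U [UU FU]] := ultraFilterLemma (fine_filter_proper (circle R)).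
pose P p := gpow phi (na p).1; pose A p := single j (na p).2.
have GP p : G (P p) by exact: gpow_in.
have tA p : trivial_on_torsion (A p).
  by have [_ h1 h2 _ _] := hna p; exact: single_trivial_on_torsion.
have hQ p : calH (star (A p) (P p)) by apply: trivial_on_torsion_star => //; exact: GH.
have [th cth] := ptcvg_ultra_limit P UU.
have [be cbe] := ptcvg_ultra_limit (fun p => star (A p) (P p)) UU.
have small x e : 0 < e -> U [set p | cnorm ((na p).2 x) < e].
  move=> e0; apply: FU.
  apply: filterS (filterI (fine_filter_in x) (fine_filter_inv _ e0)).
  by move=> p /= [xp /(lt_trans _)]; apply; have [_ _ _ h _] := hna p; exact: h.
have cA : ptcvg U A (zero_tilde R).
  move=> k x e e0; apply: filterS (small x e e0) => p /= h.
  rewrite zero_tildeE /A /single; case: eqP => _; first by rewrite subrr cnorm0.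
  by rewrite subr0; case: eqP => _; rewrite ?cnorm0.
have uth : unital th.
  move=> x; apply: (ptcvg_eq _ cth); apply: (@filterS _ U _ _ _ _ filterT) => p _ /=.
  exact: (calH_unital (GH (GP p))).
have ube : unital be.
  move=> x; apply: (ptcvg_eq _ cbe); apply: (@filterS _ U _ _ _ _ filterT) => p _ /=.
  exact: (calH_unital (hQ p)).
have tth : trivial_on_torsion th.
  split => //; first by apply: (ptcvg_homs _ _ cth) => p; exact/calH_homs/GH.
  move=> k k0 x tx; apply: (ptcvg_eq _ cth).
  have [y [t t0 yt] <-] := torsion_div (fact_gt0 k) tx.
  apply: FU; apply: filterS (fine_filter_ge _ t) => p /= tp.
  apply: calH_torsion_vanish => //; [exact: GH|by exists t|].
  rewrite /P (gpow_low _ _ (i := 1%N)) //; last by move=> [|[]].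
  have [/dvdnP[q ->] _ _ _ _] := hna p.
  have /dvdnP[r ->] : (t %| p.2`!)%N by rewrite dvdn_fact// t0.
  by rewrite -(morphMn (hh _)) mulnA [(_ * t)%N]mulnC mulrnA yt mul0rn (morph0 (hh _)).
have diff k x (c : circle R) : (forall e : R, 0 < e -> U [set p |
      cnorm ((if (j <= k)%N then (na p).2 (P p (k - j)%N x) else 0) - c) < e]) ->
    be k x - th k x = c.
  move=> h; apply: (ptcvg_diff _ cbe cth) => e e0.
  apply: filterS (h _ e0) => p /=.
  by rewrite star_singlel// [P p k x + _]addrC addrK.
have tbe : trivial_on_torsion be.
  split => //; first by apply: (ptcvg_homs _ _ cbe) => p; exact/calH_homs.
  move=> k k0 x tx; have [_ _ /(_ k k0 x tx) thx] := tth.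
  rewrite -[LHS]subr0 -[X in _ - X]thx; apply: diff => e e0.
  apply: (@filterS _ U _ _ _ _ filterT) => p _ /=.
  case: leqP => _; rewrite ?subrr ?cnorm0//.
  have [_ _ h _ _] := hna p; rewrite h ?subrr ?cnorm0//.
  exact: (morph_torsion (calH_homs (GH (GP p)) _) tx).
have Gth : G th.
  by apply: (limit_in_subgroup _ GP _ cth); exact: trivial_on_torsion_calH.
have Gbe : G be.
  by apply: (limit_mod_subgroup _ tA GP cA _ cbe); exact: trivial_on_torsion_calH.
have ij0 : (0 < i + j)%N by rewrite addn_gt0 i0.
(* The discrepancy is [a] applied to entry [k - j] of the power: for [k = j] it is [a x], which
   tends to 0, and for [0 < k - j < i] that entry vanishes. *)
have agree k x : (k < i + j)%N -> be k x = th k x.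
  move=> kij; apply/eqP; rewrite -subr_eq0; apply/eqP; apply: diff => e e0.
  apply: filterS (small x e e0) => p /= h; rewrite subr0.
  case: leqP => jk; last by rewrite cnorm0.
  have [->|kj] := posnP (k - j)%N; first by rewrite (calH_unital (GH (GP p))).
  have kji : (k - j < i)%N by rewrite ltn_subLR// addnC.
  have [_ aD _ _ _] := hna p.
  by rewrite /P (gpow_low _ _ Gphi lphi kj (ltnW kji)) lphi// mul0rn (morph0 aD) cnorm0.
have [c [Gc lc cE]] := leading_diff ij0 Gbe Gth agree.
exists c; split => // x; rewrite cE; apply: diff => e e0.
(* In degree [i + j] the discrepancy is [a] of a multiple of [phi i x], which equals [f (phi i x)]
   once [x] is in the finite set. *)
apply: FU; apply: filterS (fine_filter_in x) => p /= xp.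
rewrite leq_addl addnK /P (gpow_low _ _ _ lphi)//.
have [_ aD _ _ h] := hna p.
by rewrite (morphMn aD) h// subrr cnorm0.
Qed.

(** Elements of [G] approximate [chi] one degree at a time: left multiplication by an element with
    suitable leading entry corrects the next degree and preserves the lower ones. Closedness of [G]
    concludes. *)
Lemma subgroup_absorbs phi i chi : coset_kernel G phi -> (0 < i)%N -> low i phi ->
  (exists x, phi i x != 0) -> trivial_on_torsion chi -> low i.+1 chi -> G chi.
Proof.
move=> Kphi i0 lphi [y1 phiy] tchi lchi; have Gphi := coset_kernel_sub Kphi.
have hh := calH_homs (GH Gphi); have [hchi uchi kchi] := tchi.
have lead l f : (i < l)%N -> {morph f : x y / x + y} -> kills_torsion f ->
    leading l (fun x => phi i (f x)).
  move=> il fD ft; have j0 : (0 < l - i)%N by rewrite subn_gt0.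
  have l0 : (0 < l)%N by rewrite (leq_ltn_trans _ il).
  have := leading_commutator Kphi i0 j0 lphi fD ft.
  have := leading_comp Gphi i0 j0 lphi fD ft.
  rewrite subnKC ?(ltnW il)// => h1 h2; have [c [Gc lc cE]] := leadingD l0 h2 h1.
  by exists c; split => // x; rewrite cE subrK.
have approx d (s : seq (circle R)) (e : R) : 0 < e -> exists g, [/\ G g, low i.+1 g &
    forall k x, (k <= d)%N -> x \in s -> cnorm (g k x - chi k x) < e].
  move=> e0; elim: d => [|d [g [Gg lg hg]]].
    exists (zero_tilde R); split => //.
      by move=> [//|k] x _ _; rewrite zero_tildeE.
    by move=> [|//] x _ _; rewrite uchi zero_tildeE subrr cnorm0.
  have [di|id] := leqP d.+1 i.
    exists g; split => // k x; rewrite leq_eqVlt => /predU1P[->|]; last exact: hg.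
    by rewrite lg// lchi// subrr cnorm0.
  have hgH := GH Gg; have ug := calH_unital hgH.
  have gD := calH_homs hgH d.+1.
  pose h x := chi d.+1 x - g d.+1 x.
  have hD : {morph h : x y / x + y}.
    by move=> x y; rewrite /h hchi gD opprD addrACA.
  (* As [i > 0], [low i.+1 g] makes [g 1] zero, so [g] agrees with the identity on torsion in every
     degree. *)
  have ht : kills_torsion h.
    move=> x tx; rewrite /h kchi// sub0r; apply/eqP; rewrite oppr_eq0; apply/eqP.
    rewrite (calH_torsion_ext hgH (zero_tilde_calH R))// ?zero_tildeE//.
    by move=> z tz; rewrite lg// zero_tildeE.
  have [f [fD ft fh]] := approx_comp s (hh i) phiy hD ht e0.
  have [c [Gc lc cE]] := lead _ _ id fD ft.
  have uc := calH_unital (GH Gc).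
  exists (star c g); split; first exact: GM.
    move=> k x k0 ki; have kd : (k < d.+1)%N := leq_trans ki id.
    by rewrite (star_lowl _ uc ug lc k0 (ltnW kd)) lc// lg// addr0.
  move=> [|k] x; first by rewrite star_unital// uchi subrr cnorm0.
  move=> kd xs; rewrite (star_lowl _ uc ug lc)//.
  move: kd; rewrite leq_eqVlt => /predU1P[[->]|kd].
    by rewrite cE; have := fh _ xs; rewrite /h opprB addrA.
  by rewrite lc// add0r; exact: hg.
have e0 (p : seq (circle R) * nat) : 0 < p.2.+1%:R^-1 :> R by rewrite invr_gt0 ltr0n.
have [g hg] := choice (fun p => approx p.2 p.1 _ (e0 p)).
apply: (limit_in_subgroup (fine_filter_proper (circle R)) (v := g)).
- by move=> p; have [] := hg p.
- exact: trivial_on_torsion_calH.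
move=> k x e e1; apply: filterS (filterI (filterI (fine_filter_in x)
  (fine_filter_ge _ k)) (fine_filter_inv _ e1)) => p /= [[xp kp]].
by apply: lt_trans; have [_ _] := hg p; exact.
Qed.

End Subgroup.

(** * Saturation and the kernel *)

Section Kernel.
Variables (R : realType) (G : set (map_seq R)).
Hypotheses (hG : is_subgroup G) (hT2 : hausdorff_space (coset_space G)).
Implicit Types (phi psi chi g h : map_seq R).

Lemma saturation_sup n : G `<=` saturation n G.
Proof. by case: hG => GH _ _ _ g Gg; split; [exact: GH|exists g]. Qed.

(** If [h] agrees with [g] in [G] up to degree [i], then [h] times the inverse of [g] is trivial in
    degrees [1..i] and is absorbed by [G]. *)
Lemma saturation_of_kernel phi i : coset_kernel G phi -> (0 < i)%N -> low i phi ->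
  (exists x, phi i x != 0) -> saturation i G = G.
Proof.
move=> Kphi i0 lphi phii; case: (hG) => GH _ GM GV.
apply/seteqP; split; last exact: saturation_sup.
move=> h [hh [g Gg rgh]].
have gh k : (k < i.+1)%N -> h k = g k.
  by move=> ki; have := congr1 (fun u => u (Ordinal ki)) rgh; rewrite /rho /= => ->.
have [g' Gg' [gg' g'g]] := GV _ Gg.
have [hg hg'] := (GH _ Gg, GH _ Gg').
(* Since [i > 0], the entries of degree 1 agree, and these determine all values on torsion. *)
have tgh k x : torsion x -> h k x = g k x.
  by apply: calH_torsion_ext => // y _; rewrite gh.
have cE k : (k < i.+1)%N -> star h g' k = zero_tilde R k.
  by move=> ki; rewrite (star_agree _ gh)// gg'.
have tc : trivial_on_torsion (star h g').
  split.
  - by apply: star_homs; exact: calH_homs.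
  - by apply: star_unital; exact: calH_unital.
  move=> [//|k] _ x tx.
  transitivity (star g g' k.+1 x); last by rewrite gg' zero_tildeE.
  rewrite !starE; apply: eq_bigr => j _; apply: tgh.
  exact: (morph_torsion (calH_homs hg' j) tx).
have Gc : G (star h g').
  apply: (subgroup_absorbs hG hT2 Kphi i0 lphi phii tc) => k x k0 ki.
  by rewrite cE// zero_tildeE eqn0Ngt k0.
rewrite -(star1r (calH_homs hh)) -g'g -starA; last exact: calH_homs.
exact: GM.
Qed.

(** The conjugate [g] with [star psi g = star phi psi] agrees with [phi] up to degree [m], so it
    lies in the saturation of [G]. *)
Lemma low_in_kernel phi m : (0 < m)%N -> saturation m G = G -> G phi -> low m phi ->
  coset_kernel G phi.
Proof.
move=> m0 satm Gphi lphi; case: (hG) => GH _ GM GV.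
have hphi := GH _ Gphi; have [fh fu] := (calH_homs hphi, calH_unital hphi).
split => // psi hpsi; have [ph pu] := (calH_homs hpsi, calH_unital hpsi).
have [g [gh gE]] := star_left_division pu ph (star_homs fh ph).
have gphi k x : (k <= m)%N -> g k x = phi k x.
  rewrite -ltnS; move: k; apply: (star_cancel pu) => -[|k] km.
    by rewrite gE !star0 !fu pu.
  by rewrite gE (star_lowl _ fu pu lphi)// (star_lowr _ fu pu ph lphi)// addrC.
(* At torsion points homomorphisms commute, so reversing the order of summation exchanges the two
   factors of [star]. *)
have gtors k x : torsion x -> g k x = phi k x.
  move=> tx; apply: (@star_cancel _ psi g phi x k.+1 pu _ k (ltnSn k)) => l _.
  rewrite gE !starE (reindex_inj rev_ord_inj) /=; apply: eq_bigr => j _.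
  rewrite subSS subKn -1?ltnS//.
  exact: (torsion_commute (fh _) (ph _) tx).
have hg : calH g.
  apply: (calH_transfer hphi) => //.
  by move=> x; rewrite gphi.
have Gg : G g.
  rewrite -satm; split => //; exists phi => //.
  by apply/funext => k; apply/funext => x; rewrite /rho gphi// -ltnS.
by rewrite -gE; exact: lcoset_starr.
Qed.

Lemma first_nontrivial phi n : calH phi ->
  ~ (forall k, (k < n)%N -> phi k = zero_tilde R k) ->
  exists i, [/\ (0 < i)%N, (i < n)%N, low i phi & exists x, phi i x != 0].
Proof.
move=> hphi nz.
have ex : exists i, (i < n)%N && `[< phi i <> zero_tilde R i >].
  apply: contrapT => h; apply: nz => k kn; apply: contrapT => hk.
  by apply: h; exists k; rewrite kn; apply/asboolP.
case: (ex_minnP ex) => i /andP[ilt /asboolP hi] imin.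
have i0 : (0 < i)%N.
  rewrite lt0n; apply/eqP => i0; apply: hi; apply/funext => x.
  by rewrite i0 calH_unital// zero_tildeE.
exists i; split => //.
- move=> k x k0 ki; have -> : phi k = zero_tilde R k.
    apply: contrapT => hk; have : (i <= k)%N.
      by apply: imin; rewrite (ltn_trans ki ilt); apply/asboolP.
    by rewrite leqNgt ki.
  by rewrite zero_tildeE eqn0Ngt k0.
- apply: contrapT => h; apply: hi; apply/funext => x.
  rewrite zero_tildeE (eqn0Ngt i) i0; apply/eqP/negPn/negP => nx.
  by apply: h; exists x.
Qed.

End Kernel.

Theorem theorem5p5 (R : realType) (G : set (map_seq R))
    (hG : is_subgroup G) (hT2 : hausdorff_space (coset_space G)) :
  (forall m : nat,
     (0 < m)%N ->
     saturation m G = G ->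
     (forall n : nat, (0 < n)%N -> (n < m)%N -> saturation n G <> G) ->
     coset_kernel G =
       [set phi | G phi /\
          forall k : nat, (k <= m - 1)%N -> phi k = zero_tilde R k]) /\
  ((forall m : nat, (0 < m)%N -> G `<` saturation m G) ->
     coset_kernel G = [set zero_tilde R]).
Proof.
have KG := coset_kernel_sub hG; have GH : G `<=` calH (R:=R) by case: hG.
split=> [m m0 satm minm|nsat].
  apply/seteqP; split => phi.
    move=> Kphi; split; first exact: KG.
    have hphi := GH _ (KG _ Kphi).
    move=> k; rewrite subn1 -ltnS prednK// => km; apply: contrapT => hk.
    have [|i [i0 im li ni]] := @first_nontrivial _ phi m hphi.
      by move=> /(_ _ km).
    (* A nontrivial entry in a degree [i < m] would make [G] saturated at [i], against the
       minimality of [m]. *)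
    by apply: (minm i i0 im); exact: (saturation_of_kernel hG hT2 Kphi).
  move=> [Gphi phi0]; apply: (low_in_kernel hG m0 satm Gphi) => k x k0 km.
  by rewrite phi0 ?zero_tildeE ?eqn0Ngt ?k0// subn1 -ltnS prednK.
apply/seteqP; split => phi.
  move=> Kphi; apply/funext => k; apply: contrapT => hk.
  (* The bound [k.+1] includes the degree [k] in which [phi] was assumed nontrivial. *)
  have [|i [i0 _ li ni]] := @first_nontrivial _ phi k.+1 (GH _ (KG _ Kphi)).
    by move=> /(_ _ (ltnSn k)).
  have := nsat i i0; rewrite (saturation_of_kernel hG hT2 Kphi i0 li ni).
  by rewrite properEneq => -[/eqP].
move=> ->; split; first exact: zero_tilde_calH.
by move=> psi _; rewrite star1l.
Qed.
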